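(* Let $m\ge3$ and $\lambda_m=(2\lfloor m/2\rfloor+2)\pi$. For any $r>0$ and $c>2-\frac{r}{\lambda_m/2+2\pi}$, there exists an $(r,cr)$-LSH structure for the polygonal $D_1$ distance for $n$ polygons, each with at most $m$ vertices. This structure requires $O((nm)^{1+\rho})$ extra space and preprocessing time, and $O(m^{1+\rho}n^{\rho}\log(nm))$ query time, where $\tilde r=r/(\lambda_m+4\pi)$ and \[\rho=\frac{\log\left(1-(2-2\tilde r)\tilde r\right)}{\log(1-c\tilde r)}.\]
   Context: Polygons are simple, with no three consecutive vertices collinear. For such a polygon $P$ scaled to perimeter $1$ with a reference point $O$ on its boundary, the turning function $t_P:[0,1]\to\mathbb{R}$ gives the cumulative angle between the $x$-axis and the counterclockwise tangent at the boundary point at counterclockwise arc-length $s$ from $O$ (with $t_P(0)\in[0,2\pi)$, constant on edges, changing at vertices by the signed turning angle). The $2\pi$-extension of $f:[0,1]\to\mathbb{R}$ is $f^{2\pi}(x)=f(x)$ on $[0,1]$, $f^{2\pi}(x)=f(x-1)+2\pi$ on $(1,2]$; $D_1(f,g)=\min_{\alpha\in\mathbb{R},\,u\in[0,1]}\int_0^1|f^{2\pi}(x+u)+\alpha-g(x)|\,dx$, and the polygonal distance is $D_1(P,Q)=D_1(t_P,t_Q)$. An $(r,cr)$-LSH structure for a distance $d$ is a data structure storing $n$ data objects such that, for any query $q$, if some data object is at distance at most $r$ from $q$, then with constant probability it returns a data object at distance at most $cr$ from $q$. Complexity bounds suppress the factor $1/p_1$ and the time to evaluate a hash or a distance.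
   Formalization: Also assumes c ≥ 1: for r above λ_m/2+2π the stated condition allows c near 0, where the claim fails (one data polygon at distance between cr and r). When c·r̃ ≥ 1, where the formula is undefined, ρ is read as 0. A concatenated hash counts as one hash evaluation. *)

(* Defs.v *)
From HB Require Import structures.
From mathcomp Require Import all_boot all_order all_algebra.
From mathcomp Require Import all_classical all_reals all_analysis.
Set Implicit Arguments.
Unset Strict Implicit.
Unset Printing Implicit Defensive.
Import Order.TTheory GRing.Theory Num.Theory.
Import numFieldNormedType.Exports.
Local Open Scope classical_set_scope.
Local Open Scope ring_scope.

(** * Polygons and their turning functions *)

Section PlaneVectors.
Context {R : realType}.
Implicit Types v w : R * R.

Definition dot v w : R := v.1 * w.1 + v.2 * w.2.
Definition cross v w : R := v.1 * w.2 - v.2 * w.1.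
Definition vnorm v : R := Num.sqrt (dot v v).

(* The angle in [0, 2 pi[ from the x-axis to v. *)
Definition direction v : R :=
  if 0 <= v.2 then acos (v.1 / vnorm v) else 2 * pi - acos (v.1 / vnorm v).

(* The signed angle in ]-pi, pi[ from v to w, positive for a left turn; it is
   only used for non-parallel v and w. *)
Definition signed_angle v w : R :=
  Num.sg (cross v w) * acos (dot v w / (vnorm v * vnorm w)).

End PlaneVectors.

Section ClosedChains.
Context {R : realType}.
Variable vs : seq (R * R).

(* Vertices and edges are indexed cyclically; edge i runs from vertex i to
   vertex i + 1, so the edge that enters vertex i is edge (i + size vs - 1). *)
Definition vertex (i : nat) : R * R := nth (0, 0) vs (i %% size vs)%N.

Definition edge (i : nat) : R * R :=
  ((vertex i.+1).1 - (vertex i).1, (vertex i.+1).2 - (vertex i).2).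

Definition edge_point (i : nat) (s : R) : R * R :=
  ((vertex i).1 + s * (edge i).1, (vertex i).2 + s * (edge i).2).

Definition turn (i : nat) : R :=
  signed_angle (edge (i + (size vs).-1)) (edge i).

Definition perimeter : R := \sum_(i < size vs) vnorm (edge i).

(* Arc length from vertex 0 to vertex i once the perimeter is scaled to 1. *)
Definition arc_pos (i : nat) : R := (\sum_(j < i) vnorm (edge j)) / perimeter.

(* The boundary is a simple closed curve: the half-open edges are injectively
   parametrized and pairwise disjoint. *)
Definition simple_chain : Prop :=
  forall (i j : nat) (s t : R), (i < size vs)%N -> (j < size vs)%N ->
    0 <= s < 1 -> 0 <= t < 1 ->
    edge_point i s = edge_point j t -> i = j /\ s = t.

Definition no_three_collinear : Prop :=
  forall i : nat, (i < size vs)%N -> cross (edge i) (edge i.+1) != 0.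

(* The total turning of a simple closed polygonal curve is 2 pi or - 2 pi,
   according to its orientation. *)
Definition counterclockwise : Prop := \sum_(i < size vs) turn i = 2 * pi.

End ClosedChains.

(* [ref_pos] is the counterclockwise arc length from vertex 0 to the reference
   point O, for perimeter 1; O need not be a vertex. *)
Record polygon (R : realType) := Polygon {
  vertices :> seq (R * R);
  ref_pos : R;
  polygon_size : (3 <= size vertices)%N;
  polygon_simple : simple_chain vertices;
  polygon_collinear : no_three_collinear vertices;
  polygon_ccw : counterclockwise vertices;
  polygon_ref : 0 <= ref_pos < 1 }.

Section TurningFunction.
Context {R : realType}.
Implicit Types P Q : polygon R.

Definition ref_edge P : nat :=
  \max_(i < size P | arc_pos P i <= ref_pos P) i.

(* Counterclockwise arc length in ]0, 1] from O to vertex i; it is 1, not 0,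
   when O is vertex i, since the initial direction is then already that of the
   edge that leaves vertex i. *)
Definition arc_from_ref P (i : nat) : R :=
  if ref_pos P < arc_pos P i then arc_pos P i - ref_pos P
  else arc_pos P i - ref_pos P + 1.

Definition turning P (s : R) : R :=
  direction (edge P (ref_edge P)) +
  \sum_(i < size P | arc_from_ref P i <= s) turn P i.

Definition ext2pi (f : R -> R) (x : R) : R :=
  if x <= 1 then f x else f (x - 1) + 2 * pi.

(* For turning functions the infimum is attained. *)
Definition D1 (f g : R -> R) : R :=
  inf [set d : R | exists alpha u : R, 0 <= u <= 1 /\
    d = (\int[lebesgue_measure]_(x in `[0%R, 1%R]%classic)
           `| ext2pi f (x + u) + alpha - g x |)%R].

Definition polygon_dist P Q : R := D1 (turning P) (turning Q).

End TurningFunction.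

Definition polygon_le (R : realType) (m : nat) : Type :=
  {P : polygon R | (size P <= m)%N}.

Definition polygon_le_dist (R : realType) (m : nat) (P Q : polygon_le R m) : R :=
  polygon_dist (sval P) (sval Q).

(** * A random access machine with a hash oracle and a distance oracle *)

(* Programs work on named variables and on an array of words.  [Hash x l i]
   stores in x the value of the l-th hash function on the i-th object;
   [Near x i j] stores in x whether the distance between the i-th and the j-th
   objects is at most the threshold.  Each command takes one step: expressions
   have constant size in a fixed program, and the time to evaluate a hash or a
   distance is not counted. *)
Inductive expr :=
| Cst of nat
| Var of nat
| Add of expr & expr
| Sub of expr & expr
| Mul of expr & expr
| Div of expr & expr
| Leq of expr & expr.

Inductive cmd :=
| Skip
| Assign of nat & expr
| Read of nat & expr
| Write of expr & expr
| Hash of nat & expr & expr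
| Near of nat & expr & expr
| Seq of cmd & cmd
| If of expr & cmd & cmd
| While of expr & cmd.

Fixpoint eval (v : nat -> nat) (e : expr) : nat :=
  match e with
  | Cst k => k
  | Var x => v x
  | Add a b => eval v a + eval v b
  | Sub a b => eval v a - eval v b
  | Mul a b => eval v a * eval v b
  | Div a b => eval v a %/ eval v b
  | Leq a b => (eval v a <= eval v b)%N
  end%N.

Definition update (v : nat -> nat) (x k : nat) : nat -> nat :=
  fun y => if y == x then k else v y.

Section Machine.
Variables (T : Type) (objs : seq T).
Variables (hash : nat -> T -> nat) (near : rel T).
Variables (word space : nat).

(* [exec c v a t v' a'] : from the variables v and the array a, the command c
   halts after t steps with the variables v' and the array a'.  There is no
   such execution if a value that is not less than [word] is stored, if the
   array is accessed outside its first [space] cells, or if an oracle is called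
   on an object that does not exist. *)
Inductive exec : cmd -> (nat -> nat) -> (nat -> nat) -> nat ->
                 (nat -> nat) -> (nat -> nat) -> Prop :=
| ExecSkip v a : exec Skip v a 1 v a
| ExecAssign x e v a :
    (eval v e < word)%N ->
    exec (Assign x e) v a 1 (update v x (eval v e)) a
| ExecRead x e v a :
    (eval v e < space)%N ->
    exec (Read x e) v a 1 (update v x (a (eval v e))) a
| ExecWrite e e' v a :
    (eval v e < space)%N -> (eval v e' < word)%N ->
    exec (Write e e') v a 1 v (update a (eval v e) (eval v e'))
| ExecHash x el ei v a o :
    onth objs (eval v ei) = Some o -> (hash (eval v el) o < word)%N ->
    exec (Hash x el ei) v a 1 (update v x (hash (eval v el) o)) a
| ExecNear x ei ej v a o o' :
    onth objs (eval v ei) = Some o -> onth objs (eval v ej) = Some o' ->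
    exec (Near x ei ej) v a 1 (update v x (near o o')) a
| ExecSeq c c' v a t v' a' t' v'' a'' :
    exec c v a t v' a' -> exec c' v' a' t' v'' a'' ->
    exec (Seq c c') v a (t + t')%N v'' a''
| ExecIfTrue e c c' v a t v' a' :
    eval v e != 0%N -> exec c v a t v' a' ->
    exec (If e c c') v a t.+1 v' a'
| ExecIfFalse e c c' v a t v' a' :
    eval v e = 0%N -> exec c' v a t v' a' ->
    exec (If e c c') v a t.+1 v' a'
| ExecWhileTrue e c v a t v' a' t' v'' a'' :
    eval v e != 0%N -> exec c v a t v' a' ->
    exec (While e c) v' a' t' v'' a'' ->
    exec (While e c) v a (t + t').+1 v'' a''
| ExecWhileFalse e c v a :
    eval v e = 0%N -> exec (While e c) v a 1 v a.

End Machine.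

(** * Locality-sensitive hashing structures *)

Section LSH.
Context {R : realType}.

(* The preprocessing program [prep] and the query program [query] form an
   (r, r')-LSH structure for n objects and the distance d, with success
   probability p.  The variables initially hold the words [params], and 0
   beyond; the array of [space] words is initially 0.  All the randomness is in
   the hash functions: the law of the family is fixed before the data and the
   query, and a family member may be a concatenation of elementary hashes.  The query is object n, the data are objects 0, ..., n - 1; the query
   program leaves the array as it found it, and its answer is the final value
   of variable 0.  The time bounds hold for all outcomes, data and queries. *)
Definition LSH_structure (T : Type) (d : T -> T -> R) (n : nat) (r r' p : R)
    (prep query : cmd) (word : nat) (params : seq nat)
    (space : nat) (prep_time query_time : R) : Prop :=
  all (fun k => (k < word)%N) params /\
  exists (disp : measure_display) (Omega : measurableType disp)
         (Pr : probability Omega R) (hash : Omega -> nat -> T -> nat),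
    (forall l x k, measurable [set omega | hash omega l x = k]) /\
    forall data : n.-tuple T,
    let near : rel T := fun x y => d x y <= r' in
    let built omega t v a :=
      exec data (hash omega) near word space prep
        (nth 0%N params) (fun=> 0%N) t v a in
    let answered omega q a t v a' :=
      exec (rcons data q) (hash omega) near word space query
        (nth 0%N params) a t v a' in
    (forall omega, exists t v a,
       [/\ built omega t v a, t%:R <= prep_time &
           forall q, exists t' v',
             answered omega q a t' v' a /\ t'%:R <= query_time]) /\
    (forall q, (exists i, d (tnth data i) q <= r) ->
       exists E : set Omega,
         [/\ measurable E, (p%:E <= Pr E)%E &
             forall omega, E omega ->
               exists t v a t' v' a' (i : 'I_n),
                 [/\ built omega t v a, answered omega q a t' v' a',
                     v' 0%N = i & d (tnth data i) q <= r']]).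

End LSH.

Section Bounds.
Context {R : realType}.

Definition lambda (m : nat) : R := (2 * m./2 + 2)%N%:R * pi.

Definition scaled_radius (m : nat) (r : R) : R := r / (lambda m + 4 * pi).

(* If 1 <= c * rt, then ln (1 - c * rt) is 0 by convention, and so is the
   quotient; this is also its limit when c * rt tends to 1 from below. *)
Definition rho (m : nat) (r c : R) : R :=
  let rt := scaled_radius m r in
  ln (1 - (2 - 2 * rt) * rt) / ln (1 - c * rt).

End Bounds.

(* Main.v *)
Require Import Defs.
From HB Require Import structures.
From mathcomp Require Import all_boot all_order all_algebra.
From mathcomp Require Import all_classical all_reals all_analysis.
From mathcomp Require Import measurable_realfun zify lra ring.
Set Implicit Arguments.
Unset Strict Implicit.
Unset Printing Implicit Defensive.
Import Order.TTheory GRing.Theory Num.Theory.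
Import numFieldNormedType.Exports.
Local Open Scope classical_set_scope.
Local Open Scope ring_scope.

(* A hash family for the polygonal distance is obtained by normalizing and
   sampling.  Among all shifts of a turning function against another one, an
   optimal one aligns a breakpoint of the first with a breakpoint of the second,
   because the L1 distance is a piecewise linear function of the shift whose
   slope changes only at alignments.  So a polygon is represented by its at most
   m slides, the turning functions read from each of its vertices, and the
   vertical translation is removed by subtracting the mean.  A slide has span at
   most w = lambda m / 2 + 2 pi, whence L1 distance at most (2 - r / w) r between
   the reduced slides if the distance is at most r.  A uniform random point of
   [0, 1] x [- w, w] then hashes a slide to the side of its graph on which the
   point lies, and two slides collide with probability
   1 - (L1 distance) / (2 w).

   The random points are drawn from a grid so fine that the error is absorbed by
   the constants.  This makes the probability space finite and turns the
   integrals into sums over a period; piecewise linearity between alignments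
   becomes discrete harmonicity.

   The structure concatenates k sampled bits and reduces them by a random
   function to a key less than n m, in each of about (n m)^rho tables.  With
   probability at least 3/4 the near pair of slides collides in some table, and
   by Markov's inequality the far collisions are few with probability at least
   1/2, so a query that inspects a bounded number of entries of the buckets,
   which are linked lists, succeeds with probability at least 1/4.  If
   c r >= w, every polygon is an answer. *)

(** * Mean reduction *)

Section MeanReduction.
Variables (R : realFieldType) (M : nat).
Hypothesis M_gt0 : (0 < M)%N.
Implicit Types f g h : 'I_M -> R.

Definition mean h : R := (\sum_i h i) / M%:R.
Definition l1 h : R := mean (fun i => `|h i|).

Lemma gt0_natr : 0 < M%:R :> R. Proof. by rewrite ltr0n. Qed.

Lemma meanD f g : mean (fun i => f i + g i) = mean f + mean g.
Proof. by rewrite /mean big_split mulrDl. Qed.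

Lemma meanZ a f : mean (fun i => a * f i) = a * mean f.
Proof. by rewrite /mean -big_distrr /= mulrA. Qed.

Lemma meanN f : mean (fun i => - f i) = - mean f.
Proof. by rewrite /mean sumrN mulNr. Qed.

Lemma mean_cst a : mean (fun=> a) = a.
Proof.
by rewrite /mean sumr_const card_ord -[_ *+ M]mulr_natr mulfK // gt_eqF // gt0_natr.
Qed.

Lemma le_mean f g : (forall i, f i <= g i) -> mean f <= mean g.
Proof. by move=> fg; rewrite ler_pM2r ?invr_gt0 ?gt0_natr // ler_sum. Qed.

Lemma eq_mean f g : f =1 g -> mean f = mean g.
Proof. by move=> fg; congr (_ / _); apply: eq_bigr. Qed.

Let pos (x : R) := Num.max x 0.

Lemma posP x : (x <= 0 /\ pos x = 0) \/ (0 < x /\ pos x = x).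
Proof. by rewrite /pos; case: (leP x 0) => ?; [left|right]. Qed.

Lemma norm_pos x : `|x| = 2 * pos x - x.
Proof.
case: (posP x) => -[x0 ->]; first by rewrite ler0_norm //; lra.
by rewrite gtr0_norm //; lra.
Qed.

(* With p, q the means of the positive and negative parts of h, a = max h and
   mu = mean h, the function |h - mu| has mean
   2 mean (h - mu)^+ <= 2 p (1 - mu / a), where a <= 2 w + min h <= 2 w - 2 q
   because at most half of the values are negative. *)
Lemma l1_sub_mean_ge0 h w : 0 < w ->
  (forall i j, h i - h j <= 2 * w) ->
  (exists i, h i = 0) ->
  (#|[pred i | (h i < 0)%R]|.*2 <= M)%N ->
  l1 h <= w -> 0 <= mean h ->
  l1 (fun i => h i - mean h) <= 2 * l1 h - l1 h ^+ 2 / w.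
Proof.
move=> w0 rg [z hz] med; set s := l1 h; set mu := mean h => sw mu0.
pose p := mean (fun i => pos (h i)); pose q := p - mu.
have sE : s = 2 * p - mu.
  rewrite /s /l1 (eq_mean (g := fun i => 2 * pos (h i) + - h i)); last by move=> i; exact: norm_pos.
  by rewrite meanD meanZ meanN.
have p0 : 0 <= p.
  by rewrite -(mean_cst 0); apply: le_mean => i; case: (posP (h i)) => -[? ->] //; apply: ltW.
have q0 : 0 <= q.
  by rewrite /q /mu subr_ge0; apply: le_mean => i; case: (posP (h i)) => -[? ->].
have qE : q = mean (fun i => pos (- h i)).
  rewrite /q /mu -meanN -meanD; apply: eq_mean => i.
  by case: (posP (h i)) => -[? ->]; case: (posP (- h i)) => -[? ->]; lra.
have l1E : l1 (fun i => h i - mu) = 2 * mean (fun i => pos (h i - mu)).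
  rewrite /l1 (eq_mean (g := fun i => 2 * pos (h i - mu) + - (h i + - mu))); last by move=> i; exact: norm_pos.
  by rewrite meanD meanZ meanN meanD mean_cst subrr oppr0 addr0.
rewrite l1E.
(* If [p] vanishes, then so do [q], [mu] and [s], since 0 <= [mu] = [p] - [q]. *)
have [p_eq0|p_gt0] := leP p 0.
  have mu_eq0 : mu = 0 by rewrite /q in q0; lra.
  have -> : s = 0 by lra.
  rewrite mu_eq0 (eq_mean (g := fun i => pos (h i))) -/p; last by move=> i; rewrite subr0.
  by rewrite expr2 !mul0r; lra.
have [i0 hi0] : exists i, 0 < h i.
  apply/existsP; rewrite -[X in is_true X]negbK negb_exists; apply/negP => /forallP hle.
  suff : p = 0 by lra.
  rewrite -(mean_cst 0); apply: eq_mean => i.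
  by have := hle i; case: (posP (h i)) => -[? ->] //; lra.
pose a := h [arg max_(i > i0) h i]%O.
have ha i : h i <= a.
  by rewrite /a; case: arg_maxP => // k _; apply.
have a0 : 0 < a by apply: lt_le_trans hi0 (ha i0).
have q2 : 2 * q <= 2 * w - a.
  pose c := #|[pred i | (h i < 0)%R]|.
  have le1 : \sum_i pos (- h i) <= (2 * w - a) * c%:R.
    rewrite mulr_natr /c -sumr_const.
    rewrite [X in X <= _](bigID (fun i => h i < 0)) /=.
    rewrite [X in _ + X <= _]big1 ?addr0; last first.
      by move=> i; case: (posP (- h i)) => -[? ->] //; lra.
    apply: ler_sum => i hi; have := rg [arg max_(i > i0) h i]%O i; rewrite -/a.
    by case: (posP (- h i)) => -[? ->]; lra.
  have aw : a <= 2 * w by have := rg [arg max_(i > i0) h i]%O z; rewrite -/a; lra.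
  have cM : c%:R * 2 <= M%:R :> R by rewrite -natrM ler_nat muln2.
  rewrite [X in 2 * X]qE /mean mulrA ler_pdivrMr ?gt0_natr //.
  apply: (@le_trans _ _ (2 * ((2 * w - a) * c%:R))); first by rewrite ler_pM2l.
  by rewrite mulrCA ler_wpM2l ?subr_ge0 // mulrC.
(* Where h > mu, one has h - mu = h (1 - mu / h) <= h (1 - mu / a). *)
have ub : mean (fun i => pos (h i - mu)) <= p * (1 - mu / a).
  rewrite mulrC /p -meanZ; apply: le_mean => i.
  have mua : mu / a <= 1.
    rewrite ler_pdivrMr // mul1r /mu -(mean_cst a); exact: le_mean.
  have := ha i; case: (posP (h i)) => -[hi ->] hia.
    by rewrite mulr0; case: (posP (h i - mu)) => -[? ->] //; lra.
  case: (posP (h i - mu)) => -[? ->]; first by rewrite mulr_ge0 ?subr_ge0 // ltW.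
  rewrite mulrBl mul1r lerD2l lerN2 mulrAC ler_pdivrMr //.
  by rewrite ler_wpM2l.
apply: (@le_trans _ _ (2 * (p * (1 - mu / a)))); first by rewrite ler_pM2l.
have aq : a <= 2 * w - 2 * q by lra.
have wq : 0 < w - q by lra.
apply: (@le_trans _ _ (2 * (p * (1 - mu / (2 * (w - q)))))).
  rewrite ler_pM2l // ler_pM2l // lerD2l lerN2 ler_wpM2l // lef_pV2 ?posrE ?mulr_gt0 //.
  by lra.
have -> : 2 * (p * (1 - mu / (2 * (w - q)))) = p * (2 * w - s) / (w - q).
  have -> : s = p + q by rewrite sE /q; lra.
  by have -> : mu = p - q; [rewrite /q; lra|field; lra].
have -> : 2 * s - s ^+ 2 / w = s * (2 * w - s) / w by field; lra.
rewrite ler_pdivrMr // [leRHS]mulrAC ler_pdivlMr // [leLHS]mulrAC [leRHS]mulrAC.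
apply: ler_wpM2r; first by lra.
have -> : s = p + q by rewrite sE /q; lra.
(* With [s] = [p] + [q], this product is the difference (p + q) (w - q) - p w of the two sides that
   remain. *)
have : 0 <= q * (w - (p + q)).
  by rewrite mulr_ge0 // subr_ge0 (_ : p + q = s) // sE /q; lra.
nra.
Qed.

(** A median is the least value with at least half of all values at or below it: if more than half
    lay strictly below, the largest of those would be a smaller candidate. *)
Lemma exists_median f : exists m : 'I_M,
  (#|[pred i | (f i < f m)%R]|.*2 <= M)%N /\ (#|[pred i | (f m < f i)%R]|.*2 <= M)%N.
Proof.
pose below x := #|[pred i | (f i <= x)%R]|.
pose i1 := [arg max_(i > Ordinal M_gt0) f i]%O.
have h1 : (M <= (below (f i1)).*2)%N.
  rewrite (_ : below _ = M) -?addnn ?leq_addr // /below -[RHS]card_ord.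
  apply: eq_card => i; rewrite !inE /i1; case: arg_maxP => // k _ kmax; exact: kmax.
pose m := [arg min_(i < i1 | (M <= (below (f i)).*2)%N) f i]%O.
exists m; rewrite /m; case: arg_minP => // {}m mlow mmin; split.
  rewrite leqNgt; apply/negP => mgt.
  have [j0 j0m] : exists j, f j < f m.
    apply/existsP; apply: contraTT mgt => /existsPn none.
    by rewrite eq_card0 // => i; rewrite !inE; apply/negbTE.
  pose j := [arg max_(i > j0 | f i < f m) f i]%O.
  have [jm jmax] : f j < f m /\ forall i, f i < f m -> f i <= f j.
    by rewrite /j; case: arg_maxP => // k ? kmax; split.
  have : (M <= (below (f j)).*2)%N.
    apply: ltnW; rewrite (leq_trans mgt) // leq_double.
    by apply: subset_leq_card; apply/fintype.subsetP => i; rewrite !inE; apply: jmax.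
  by move=> /mmin; rewrite leNgt jm.
have e : (below (f m) + #|[pred i | (f m < f i)%R]|)%N = M.
  have := cardC [pred i | (f i <= f m)%R]; rewrite card_ord => cM; rewrite -[RHS]cM; congr addn.
  by apply: eq_card => i; rewrite !inE ltNge.
by lia.
Qed.

(** By convexity, it suffices that some subgradient at the median is nonnegative along the move [d]
    from the optimal translation. *)
Lemma l1_median f a (m : 'I_M) :
  (#|[pred i | (f i < f m)%R]|.*2 <= M)%N ->
  (#|[pred i | (f m < f i)%R]|.*2 <= M)%N ->
  l1 (fun i => f i - f m) <= l1 (fun i => f i + a).
Proof.
move=> lo hi; rewrite ler_pM2r ?invr_gt0 ?gt0_natr //.
pose v := f m; pose d := v + a.
(* [b] selects a subgradient of the norm at each value *)
have key (b : pred 'I_M) : (forall i, if b i then f i <= v else v <= f i) ->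
    0 <= d * (M%:R - #|b|%:R *+ 2) -> \sum_i `|f i - v| <= \sum_i `|f i + a|.
  move=> hb; have <- : \sum_i (if b i then - d else d) = d * (M%:R - #|b|%:R *+ 2).
    rewrite (bigID b) /= (eq_bigr (fun=> - d)); last by move=> i ->.
    rewrite [X in _ + X](eq_bigr (fun=> d)); last by move=> i /negbTE ->.
    rewrite !sumr_const [X in _ + d *+ X](_ : _ = #|predC b|); last exact: eq_card.
    have cM : #|b|%:R + #|predC b|%:R = M%:R :> R by rewrite -natrD cardC card_ord.
    by rewrite -cM -[_ *+ #|b|]mulr_natr -[d *+ _]mulr_natr -[_ *+ 2]mulr_natr; lra.
  move=> s0; apply: (@le_trans _ _ (\sum_i (`|f i - v| + (if b i then - d else d)))).
    by rewrite big_split lerDl.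
  apply: ler_sum => i _; have := hb i; case: ifP => _ fv.
    by rewrite ler0_norm ?subr_le0 // /d -normrN; apply: le_trans (ler_norm _); lra.
  by rewrite ger0_norm ?subr_ge0 // /d; apply: le_trans (ler_norm _); lra.
have half (c : nat) : (c.*2 <= M)%N -> 0 <= M%:R - c%:R *+ 2 :> R.
  by move=> cM; rewrite subr_ge0 -mulr_natr -natrM ler_nat muln2.
(* The indices with value [v] may be put on either side; they go where they contribute the absolute
   value of [d]. *)
have [d0|d0] := leP 0 d.
  apply: (key [pred i | (f i < v)%R]); first by move=> i /=; case: ltP => // /ltW.
  exact: mulr_ge0 (half _ lo).
apply: (key [pred i | (f i <= v)%R]); first by move=> i /=; case: leP => // /ltW.
apply: mulr_le0; first exact: ltW.
rewrite subr_le0 -[_ *+ 2]mulr_natr -natrM ler_nat muln2.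
have e : (#|[pred i | (f i <= v)%R]| + #|[pred i | (v < f i)%R]|)%N = M.
  have := cardC [pred i | (f i <= v)%R]; rewrite card_ord => cM; rewrite -[RHS]cM.
  by congr addn; apply: eq_card => i; rewrite !inE ltNge.
have cM : (M <= #|[pred i | (f i <= v)%R]|.*2)%N by move: hi e; rewrite -/v; lia.
apply: leq_trans cM _; rewrite leq_double.
by apply/subset_leq_card/fintype.subsetP => i; rewrite !inE.
Qed.

(** Translating by a median instead of by [a] does not increase the L1 norm, and s -> 2 s - s^2 / w
    is increasing on [0, w]. If the mean is then negative, the bound is applied to the opposite
    function. *)
Lemma l1_sub_mean_le f a w r : 0 < w ->
  (forall i j, f i - f j <= 2 * w) ->
  l1 (fun i => f i + a) <= r -> r <= w ->
  l1 (fun i => f i - mean f) <= 2 * r - r ^+ 2 / w.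
Proof.
move=> w0 rg far rw; have [m [lo hi]] := exists_median f.
pose h i := f i - f m.
have hr : l1 h <= r := le_trans (l1_median a lo hi) far.
have h0 : 0 <= l1 h by rewrite -(mean_cst 0); apply: le_mean => i; exact: normr_ge0.
have mono : 2 * l1 h - l1 h ^+ 2 / w <= 2 * r - r ^+ 2 / w.
  rewrite -subr_ge0.
  have -> : 2 * r - r ^+ 2 / w - (2 * l1 h - l1 h ^+ 2 / w) =
            (r - l1 h) * (2 * w - r - l1 h) / w by field; lra.
  by rewrite divr_ge0 ?mulr_ge0 //; lra.
apply: le_trans mono.
have mh : mean h = mean f - f m by rewrite /h meanD mean_cst.
have [mu0|mu0] := leP 0 (mean h).
  rewrite (_ : l1 _ = l1 (fun i => h i - mean h)); last first.
    by apply: eq_mean => i; rewrite mh /h; congr `|_|; lra.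
  apply: l1_sub_mean_ge0 => //.
  - by move=> i j; rewrite /h; have := rg i j; lra.
  - by exists m; rewrite /h subrr.
  - by rewrite (eq_card (B := [pred i | (f i < f m)%R])) // => i; rewrite !inE subr_lt0.
  - exact: le_trans rw.
have lN : l1 (fun i => - h i) = l1 h by apply: eq_mean => i; rewrite normrN.
rewrite (_ : l1 (fun i => f i - mean f) =
  l1 (fun i => - h i - mean (fun i => - h i))); last first.
  by apply: eq_mean => i; rewrite meanN mh /h -[LHS]normrN; congr `|_|; lra.
rewrite -lN; apply: l1_sub_mean_ge0 => //.
- by move=> i j; rewrite /h; have := rg j i; lra.
- by exists m; rewrite /h subrr oppr0.
- by rewrite (eq_card (B := [pred i | (f m < f i)%R])) // => i; rewrite !inE oppr_lt0 subr_gt0.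
- by rewrite lN; exact: le_trans rw.
- by rewrite meanN oppr_ge0 ltW.
Qed.
End MeanReduction.

(** * Alignment of periodic step functions *)

Section Alignment.
Variables (R : realFieldType) (M : nat) (T : R).
Hypothesis M_gt0 : (0 < M)%N.
Implicit Types F G e : nat -> R.

Definition quasiperiodic F := forall x, F (x + M)%N = F x + T.

Lemma quasiperiodicM F x z : quasiperiodic F -> F (x + z * M)%N = F x + T *+ z.
Proof.
move=> Fp; elim: z => [|z IH]; first by rewrite mul0n addn0 mulr0n addr0.
by rewrite mulSn addnCA addnC Fp IH mulrSr addrA.
Qed.

Lemma sum_shift e b : (forall x, e (x + M)%N = e x) ->
  \sum_(x < M) e (x + b)%N = \sum_(x < M) e x.
Proof.
move=> ep; elim: b => [|b IH]; first by apply: eq_bigr => x _; rewrite addn0.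
rewrite -{}IH; case: M M_gt0 ep => // k _ ep.
rewrite big_ord_recr [RHS]big_ord_recl /= [RHS]addrC; congr (_ + _).
  by apply: eq_bigr => x _; rewrite /bump /= addnS add1n addSn.
by rewrite addnS -addSn addnC ep add0n.
Qed.

(** Not normalized: the integral in [D1] is approximated by [gap] divided by [M]. *)
Definition gap F G (a : R) (u : nat) : R := \sum_(x < M) `|F (x + u)%N + a - G x|.

Lemma gap_shift F G a u b : quasiperiodic F -> quasiperiodic G ->
  gap F G a u = \sum_(x < M) `|F (x + b + u)%N + a - G (x + b)%N|.
Proof.
move=> Fp Gp; rewrite (@sum_shift (fun x => `|F (x + u)%N + a - G x|) b) // => x.
by rewrite addnAC Fp Gp; congr `|_|; lra.
Qed.

(** After one of the sums on each side is moved by 1, the terms agree in pairs: exchanged if [F]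
    does not jump, in place if [G] does not jump. *)
Lemma gap_harmonic F G a u : quasiperiodic F -> quasiperiodic G ->
  (forall x, F (x + u).+2 = F (x + u).+1 \/ G x.+1 = G x) ->
  gap F G a u + gap F G a u.+2 = 2 * gap F G a u.+1.
Proof.
move=> Fp Gp jump; rewrite (gap_shift a u 1 Fp Gp) mulrDl mul1r.
rewrite {2}(gap_shift a u.+1 1 Fp Gp) /gap -!big_split /=; apply: eq_bigr => x _.
rewrite !addnS !addn0 !addSn.
by have [->|->] := jump x; rewrite // addrC.
Qed.

(** Between alignments [Phi] is linear, so a first step that does not ascend is followed by others
    until an alignment is met. The next lemma is the mirror image. *)
Lemma harmonic_min_up (Phi : nat -> R) (al : pred nat) :
  (forall u, ~~ al u.+1 -> Phi u + Phi u.+2 = 2 * Phi u.+1) ->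
  forall k u, al (u + k)%N -> Phi u.+1 <= Phi u -> exists2 v, al v & Phi v <= Phi u.
Proof.
move=> harm; elim=> [|k IH] u; first by rewrite addn0; exists u.
move=> alk le1; have [al1|nal1] := boolP (al u.+1); first by exists u.+1.
have [||v alv vle] := IH u.+1; first by rewrite addSnnS.
  by have := harm _ nal1; lra.
by exists v => //; apply: le_trans le1.
Qed.

Lemma harmonic_min_down (Phi : nat -> R) (al : pred nat) :
  (forall u, ~~ al u.+1 -> Phi u + Phi u.+2 = 2 * Phi u.+1) ->
  forall k u, al u -> Phi (u + k)%N <= Phi (u + k).+1 ->
  exists2 v, al v & Phi v <= Phi (u + k).+1.
Proof.
move=> harm; elim=> [|k IH] u; first by rewrite addn0; exists u.
move=> alu; rewrite addnS => le1.
have [al1|nal1] := boolP (al (u + k).+1); first by exists (u + k).+1.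
have [||v alv vle] := IH u => //; first by have := harm _ nal1; lra.
by exists v => //; apply: le_trans le1.
Qed.

(** Away from alignments, at least one of the two directions does not ascend; [M <= u] leaves room
    for a full period of descent to the left. *)
Lemma harmonic_min (Phi : nat -> R) (al : pred nat) :
  (forall u, ~~ al u.+1 -> Phi u + Phi u.+2 = 2 * Phi u.+1) ->
  (forall u, exists2 k, (k < M)%N & al (u + k)%N) ->
  forall u, (M <= u)%N -> exists2 v, al v & Phi v <= Phi u.
Proof.
move=> harm near u Mu; have [alu|nal] := boolP (al u); first by exists u.
have [k kM alk] := near u.
have [le1|gt1] := leP (Phi u.+1) (Phi u); first exact: harmonic_min_up alk le1.
have [k' k'M alk'] := near (u - M)%N.
have uE : u = (u - M + k' + (M - k').-1).+1 by lia.
rewrite uE; apply: (harmonic_min_down harm alk').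
rewrite -uE; have := harm (u - M + k' + (M - k').-1)%N; rewrite -uE => /(_ nal).
by lra.
Qed.

Section StepFunctions.
Variables (p : nat) (c : R) (tau : 'I_p -> R) (beta : 'I_p -> nat).
Hypothesis beta_range : forall i, (0 < beta i <= M)%N.

(* The values at the integers of the step function that jumps by [tau i] at
   every integer congruent to [beta i] modulo [M]. *)
Definition stepfun (x : nat) : R :=
  c + \sum_i tau i * ((x + M - beta i) %/ M)%:R.

Lemma stepfun_quasiperiodic : \sum_i tau i = T -> quasiperiodic stepfun.
Proof.
move=> sT x; rewrite /stepfun -sT -addrA -big_split /=; congr (_ + _).
apply: eq_bigr => i _; have /andP[_ bM] := beta_range i.
rewrite (_ : x + M + M - beta i = x + M - beta i + M)%N; last by lia.
by rewrite divnDr // divnn M_gt0 natrD mulrDr mulr1.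
Qed.

Lemma stepfun_jump x : (forall i, beta i != x.+1 %[mod M]) ->
  stepfun x.+1 = stepfun x.
Proof.
move=> nj; congr (_ + _); apply: eq_bigr => i _; congr (_ * _%:R).
have /andP[_ bM] := beta_range i.
rewrite (_ : x.+1 + M - beta i = (x + M - beta i).+1)%N; last by lia.
rewrite divnS // [X in (X + _)%N](_ : _ = 0)%N //; apply/eqP; rewrite eqb0.
apply: contra (nj i) => dv; rewrite -(eqn_modDr (x.+1 + M - beta i)%N) subnKC; last by lia.
rewrite (_ : x.+1 + (x.+1 + M - beta i) = x.+1 + (x + M - beta i).+1)%N; last by lia.
by rewrite -[in X in _ == X]modnDmr (eqP dv) addn0 modnDr.
Qed.

Lemma stepfunE x : (x < M)%N -> stepfun x = c + \sum_(i | (beta i <= x)%N) tau i.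
Proof.
move=> xM; rewrite /stepfun [in RHS]big_mkcond /=; congr (_ + _).
apply: eq_bigr => i _; have /andP[b0 bM] := beta_range i.
case: leqP => bx; last by rewrite divn_small ?mulr0 //; lia.
rewrite (_ : x + M - beta i = 1 * M + (x - beta i))%N; last by lia.
by rewrite divnMDl // divn_small ?addn0 ?mulr1 //; lia.
Qed.

End StepFunctions.

Section Align.
Variables (p : nat) (c : R) (tau : 'I_p -> R) (beta : 'I_p -> nat).
Variables (p' : nat) (c' : R) (tau' : 'I_p' -> R) (beta' : 'I_p' -> nat).
Hypothesis beta_range : forall i, (0 < beta i <= M)%N.
Hypothesis beta'_range : forall i, (0 < beta' i <= M)%N.
Hypothesis sum_tau : \sum_i tau i = T.
Hypothesis sum_tau' : \sum_i tau' i = T.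
Let F := stepfun c tau beta.
Let G := stepfun c' tau' beta'.

(** Harmonicity can fail only where a jump of [F] meets a jump of [G], so a descent ends at such a
    shift. It starts at [u + M] rather than [u] to have a period below it; the translation [a - T]
    cancels the resulting increment. *)
Lemma exists_alignment a u : (0 < p)%N -> (0 < p')%N ->
  exists i j a', \sum_(x < M) `|F (x + beta i)%N - G (x + beta' j)%N + a'| <= gap F G a u.
Proof.
move=> p0 p'0.
have Fp : quasiperiodic F by apply: stepfun_quasiperiodic.
have Gp : quasiperiodic G by apply: stepfun_quasiperiodic.
pose al v := [exists i, exists j, beta i == v + beta' j %[mod M]].
have harm v : ~~ al v.+1 ->
    gap F G (a - T) v + gap F G (a - T) v.+2 = 2 * gap F G (a - T) v.+1.
  move=> nal; apply: gap_harmonic => // x.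
  have [jF|] := boolP [forall i, beta i != (x + v).+2 %[mod M]].
    by left; apply: stepfun_jump => //; apply/forallP.
  rewrite negb_forall => /existsP[i /negPn/eqP bi]; right; apply: stepfun_jump => // j.
  apply: contraNN nal => /eqP bj; apply/existsP; exists i; apply/existsP; exists j.
  by rewrite bi -modnDmr bj modnDmr; apply/eqP; congr (_ %% _)%N; lia.
have near v : exists2 k, (k < M)%N & al (v + k)%N.
  (* The witness is the residue of beta - (v + beta'); adding [M] times the subtrahend keeps the
     natural subtraction exact. *)
  exists ((beta (Ordinal p0) + M * (v + beta' (Ordinal p'0)) - (v + beta' (Ordinal p'0))) %% M)%N.
    exact: ltn_pmod.
  apply/existsP; exists (Ordinal p0); apply/existsP; exists (Ordinal p'0).
  rewrite -addnA [(_ %% M + _)%N]addnC addnA modnDmr.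
  rewrite subnKC; last by apply: leq_trans (leq_addl _ _); rewrite leq_pmull.
  by rewrite addnC [(M * _)%N]mulnC modnMDl.
have [|v /existsP[i /existsP[j /eqP bij]] vle] := harmonic_min harm near (u := u + M).
  exact: leq_addl.
have /andP[b1 b2] := beta_range i; have /andP[b1' b2'] := beta'_range j.
(* Congruence gives a multiple of [M]. It is nonnegative because [beta i] is the least positive
   member of its class, [M] itself standing for the class of 0. *)
have [z zE] : exists z, (v + beta' j = beta i + z * M)%N.
  have := divn_eq (v + beta' j) M; rewrite -bij.
  case: (ltngtP (beta i) M) b2 => // [lt _|-> _].
    by rewrite modn_small // => ->; exists ((v + beta' j) %/ M)%N; rewrite addnC.
  rewrite modnn addn0; case: (_ %/ M)%N => [|z ->]; first by lia.
  by exists z; rewrite mulSn.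
exists i, j, (T *+ z + (a - T)).
have -> : \sum_(x < M) `|F (x + beta i)%N - G (x + beta' j)%N + (T *+ z + (a - T))| =
    gap F G (a - T) v.
  rewrite (gap_shift _ _ (beta' j) Fp Gp); apply: eq_bigr => x _.
  rewrite -[in RHS]addnA [(beta' j + v)%N]addnC zE addnA (quasiperiodicM _ _ Fp).
  by congr `|_|; lra.
apply: le_trans vle _; rewrite le_eqVlt; apply/orP; left; apply/eqP.
by apply: eq_bigr => x _; rewrite addnA Fp; congr `|_|; lra.
Qed.

(** Conversely, an aligned pair is a shift by beta - beta' + M reduced modulo [M]; the correction of
    [a] accounts for the added [M] and for the removed periods. *)
Lemma alignment_shift i j a : exists u a', (u < M)%N /\
  \sum_(x < M) `|F (x + beta i)%N - G (x + beta' j)%N + a| = gap F G a' u.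
Proof.
have Fp : quasiperiodic F by apply: stepfun_quasiperiodic.
have Gp : quasiperiodic G by apply: stepfun_quasiperiodic.
have /andP[_ b2'] := beta'_range j.
pose u := (beta i + M - beta' j)%N.
exists (u %% M)%N, (a + T *+ (u %/ M) - T); split; first exact: ltn_pmod.
rewrite (gap_shift _ _ (beta' j) Fp Gp); apply: eq_bigr => x _.
have : F (x + beta' j + u)%N = F (x + beta i)%N + T.
  by rewrite -Fp; congr F; rewrite /u; lia.
rewrite {1}(divn_eq u M) [(_ * _ + _)%N]addnC addnA (quasiperiodicM _ _ Fp) => e.
congr `|_|; set A := F (x + beta i)%N in e *; set t := T *+ _ in e *.
set B := F (x + beta' j + u %% M)%N in e *; lra.
Qed.
End Align.
End Alignment.

(** * Random tables *)

Definition fraction (R : realFieldType) (A : finType) (p : pred A) : R :=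
  #|p|%:R / #|A|%:R.

Section Fraction.
Variable R : realFieldType.
Implicit Types A : finType.

Lemma fraction_ge0 A (p : pred A) : 0 <= fraction R p.
Proof. by rewrite /fraction divr_ge0 ?ler0n. Qed.

Lemma fraction_le1 A (p : pred A) : fraction R p <= 1.
Proof.
rewrite /fraction; have [->|A0] := posnP #|A|; first by rewrite invr0 mulr0.
by rewrite ler_pdivrMr ?ltr0n // mul1r ler_nat max_card.
Qed.

Lemma fraction_le A (p p' : pred A) : subpred p p' -> fraction R p <= fraction R p'.
Proof.
move=> pp'; rewrite /fraction ler_wpM2r ?invr_ge0 ?ler0n // ler_nat.
by apply/subset_leq_card/fintype.subsetP => x; rewrite !unfold_in; apply: pp'.
Qed.

Lemma fractionC A (p : pred A) : (0 < #|A|)%N ->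
  fraction R (predC p) = 1 - fraction R p.
Proof.
move=> A0; apply/eqP; rewrite eq_sym subr_eq -mulrDl -natrD addnC cardC divff //.
by rewrite pnatr_eq0 -lt0n.
Qed.

Lemma fraction_sum A (p : pred A) : fraction R p = (\sum_a (p a)%:R) / #|A|%:R.
Proof.
congr (_ / _); rewrite -sum1_card natr_sum big_mkcond; apply: eq_bigr => a _.
by rewrite unfold_in; case: (p a).
Qed.

Lemma fraction_and A (p p' : pred A) a b : (0 < #|A|)%N ->
  fraction R (predC p) <= a -> fraction R (predC p') <= b ->
  1 - a - b <= fraction R (predI p p').
Proof.
move=> A0 pa pb.
have : fraction R (predC (predI p p')) <= fraction R (predC p) + fraction R (predC p').
  rewrite -mulrDl ler_wpM2r ?invr_ge0 ?ler0n // -natrD ler_nat.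
  rewrite -cardUI (leq_trans _ (leq_addr _ _)) //.
  by apply/subset_leq_card/fintype.subsetP => x; rewrite !inE negb_and.
rewrite fractionC //; lra.
Qed.

Lemma markov A (f : A -> nat) (c : nat) (mu : R) : (0 < c)%N ->
  (\sum_a f a)%:R / #|A|%:R <= mu -> fraction R (fun a => c <= f a)%N <= mu / c%:R.
Proof.
move=> c0 le_mu; rewrite ler_pdivlMr ?ltr0n //; apply: le_trans le_mu.
rewrite fraction_sum mulrAC ler_wpM2r ?invr_ge0 ?ler0n //.
rewrite natr_sum mulr_suml; apply: ler_sum => a _.
by case: leqP => ca; rewrite ?mul0r ?ler0n // mul1r ler_nat.
Qed.

Section Product.
Variables (I A : finType).
Hypothesis A_gt0 : (0 < #|A|)%N.

Lemma fraction_all (p : pred A) :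
  fraction R (fun w : {ffun I -> A} => [forall i, p (w i)]) = fraction R p ^+ #|I|.
Proof.
rewrite /fraction expr_div_n -!natrX -card_ffun -card_ffun_on; congr (_%:R / _).
Qed.

Lemma fraction_coord (p : pred A) (i : I) :
  fraction R (fun w : {ffun I -> A} => p (w i)) = fraction R p.
Proof.
pose F (i' : I) (a : A) : R := if i' == i then (p a)%:R else 1.
have : \prod_i' \sum_a F i' a = \sum_(w : {ffun I -> A}) \prod_i' F i' (w i').
  exact: bigA_distr_bigA.
rewrite /F.
rewrite (bigD1 i) //= eqxx.
have -> : \prod_(i' | i' != i) (\sum_a (if i' == i then (p a)%:R else 1)) =
    #|A|%:R ^+ #|I|.-1 :> R.
  rewrite (eq_bigr (fun=> #|A|%:R)); last first.
    by move=> i' /negbTE ->; rewrite sumr_const.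
  by rewrite prodr_const; congr (_ ^+ _); rewrite cardC1.
rewrite [RHS](eq_bigr (fun w : {ffun I -> A} => (p (w i))%:R)); last first.
  move=> w _; rewrite (bigD1 i) //= eqxx big1 ?mulr1 // => i' /negbTE -> //.
rewrite !fraction_sum => <-; rewrite card_ffun.
have I0 : (0 < #|I|)%N by apply/card_gt0P; exists i.
rewrite -[in X in _ / X](prednK I0) expnS natrM natrX.
by field; rewrite !pnatr_eq0 -!lt0n A_gt0 expf_neq0 // pnatr_eq0 -lt0n.
Qed.

End Product.

Lemma fraction_fst (A A' : finType) (p : pred A) : (0 < #|A'|)%N ->
  fraction R (fun u : A * A' => p u.1) = fraction R p.
Proof.
move=> A'0; rewrite !fraction_sum card_prod.
rewrite -(pair_bigA _ (fun a (_ : A') => (p a)%:R)) /=.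
under eq_bigr do rewrite sumr_const.
rewrite sumrMnl -[_ *+ _]mulr_natr natrM invfM mulrACA mulrV ?mulr1 //.
by rewrite unitfE pnatr_eq0 -lt0n.
Qed.

(* Replacing the value at [u] by an arbitrary one is injective on the functions
   that agree at [u] and [v]. *)
Lemma fraction_random_collision (K : finType) (n : nat) (u v : K) : u != v ->
  fraction R (fun phi : {ffun K -> 'I_n.+1} => phi u == phi v) <= n.+1%:R^-1.
Proof.
move=> uv; pose change (z : {ffun K -> 'I_n.+1} * 'I_n.+1) : {ffun K -> 'I_n.+1} :=
  [ffun x => if x == u then z.2 else z.1 x].
pose C := [pred z : {ffun K -> 'I_n.+1} * 'I_n.+1 | z.1 u == z.1 v].
have inj : {in C &, injective change}.
  move=> [f c] [g e]; rewrite !inE /= => /eqP fuv /eqP guv /ffunP eq_fg.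
  have ce : c = e by have := eq_fg u; rewrite !ffunE eqxx.
  have fg x : x != u -> f x = g x.
    by move=> /negbTE xu; have := eq_fg x; rewrite !ffunE xu.
  congr (_, _) => //; apply/ffunP => x; have [->|/fg //] := eqVneq x u.
  by rewrite fuv guv fg // eq_sym.
have := fraction_fst (fun phi : {ffun K -> 'I_n.+1} => phi u == phi v) (A' := 'I_n.+1).
rewrite card_ord => /(_ isT) <-.
rewrite /fraction card_prod card_ord ler_pdivrMr; last first.
  by rewrite ltr0n muln_gt0 andbT card_ffun expn_gt0 card_ord.
rewrite natrM mulrCA mulVf ?pnatr_eq0 // mulr1 ler_nat.
rewrite -(card_in_imset inj); exact: max_card.
Qed.

(** * Concatenated bits in several tables *)

Section Tables.
Variables (T : Type) (A : finType) (b : T -> nat -> A -> bool) (k B L m : nat).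
Hypothesis A_gt0 : (0 < #|A|)%N.

(* One hash table: k sampled bits, followed by a random function that reduces
   them to a small key. *)
Local Notation table_seed :=
  ({ffun 'I_k -> A} * {ffun {ffun 'I_k -> bool} -> 'I_B.+1})%type.

Definition table_key (u : table_seed) (x : T) (s : nat) : 'I_B.+1 :=
  u.2 [ffun a => b x s (u.1 a)].

Definition collide x s y s' (u : table_seed) : bool :=
  table_key u x s == table_key u y s'.

Definition agree x s y s' : R := fraction R (fun a => b x s a == b y s' a).

Lemma card_table_seed_gt0 : (0 < #|{: table_seed}|)%N.
Proof. by rewrite card_prod !card_ffun !card_ord muln_gt0 !expn_gt0 A_gt0. Qed.

Lemma fraction_collide_ge x s y s' :
  agree x s y s' ^+ k <= fraction R (collide x s y s').
Proof.
rewrite -[k in _ ^+ k]card_ord -(fraction_all 'I_k).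
rewrite -(@fraction_fst _ {ffun {ffun 'I_k -> bool} -> 'I_B.+1}); last first.
  by rewrite card_ffun card_ord expn_gt0.
apply: fraction_le => u /forallP eqb; apply/eqP; congr (u.2 _).
by apply/ffunP => a; rewrite !ffunE; apply/eqP.
Qed.

(** For fixed sampled coordinates, either all [k] bits agree, or two distinct bit vectors are merged
    by the random function, which has probability at most 1 / (B + 1). *)
Lemma fraction_collide_le x s y s' :
  fraction R (collide x s y s') <= agree x s y s' ^+ k + B.+1%:R^-1.
Proof.
rewrite -[k in _ ^+ k]card_ord -(fraction_all 'I_k) !fraction_sum.
have Phi0 : 0 < #|{ffun {ffun 'I_k -> bool} -> 'I_B.+1}|%:R :> R.
  by rewrite ltr0n card_ffun card_ord expn_gt0.
have G0 : 0 < #|{ffun 'I_k -> A}|%:R :> R by rewrite ltr0n card_ffun expn_gt0 A_gt0.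
rewrite card_prod natrM ler_pdivrMr ?mulr_gt0 // mulrA mulrDl divfK ?gt_eqF //.
have -> : B.+1%:R^-1 * #|{ffun 'I_k -> A}|%:R = \sum_(g : {ffun 'I_k -> A}) B.+1%:R^-1 :> R.
  by rewrite sumr_const mulr_natr.
rewrite -big_split mulr_suml -(pair_bigA _ (fun g phi => (collide x s y s' (g, phi))%:R)) /=.
apply: ler_sum => g _; rewrite /collide /table_key /=.
set u := [ffun a => b x s (g a)]; set v := [ffun a => b y s' (g a)].
have [uv|uv] := eqVneq u v.
  rewrite (_ : [forall _, _] = true); last first.
    apply/forallP => a; have := congr1 (fun h : {ffun 'I_k -> bool} => h a) uv.
    by rewrite !ffunE => ->.
  apply: (@le_trans _ _ (\sum_(phi : {ffun {ffun 'I_k -> bool} -> 'I_B.+1}) 1)).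
    by apply: ler_sum => phi _; rewrite uv eqxx.
  by rewrite sumr_const ler_peMl ?ler0n // lerDl invr_ge0 ler0n.
have := fraction_random_collision B uv.
rewrite fraction_sum ler_pdivrMr // => /le_trans; apply.
by rewrite ler_wpM2r ?ler0n // lerDr ler0n.
Qed.

(** The index l m + s asks for slide [s] in table [l]. The offset l (B + 1) gives the tables
    disjoint ranges of keys, so a single array holds all of them. *)
Definition lsh_hash (w : {ffun 'I_L -> table_seed}) (j : nat) (x : T) : nat :=
  if (insub (j %/ m)%N : option 'I_L) is Some l then (l * B.+1 + table_key (w l) x (j %% m))%N else 0%N.

Hypothesis m_gt0 : (0 < m)%N.

Lemma lsh_hashE w (l : 'I_L) (s : 'I_m) x :
  lsh_hash w (l * m + s) x = (l * B.+1 + table_key (w l) x s)%N.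
Proof.
by rewrite /lsh_hash divnMDl // modnMDl !divn_small ?modn_small // addn0 valK.
Qed.

Lemma lsh_hash_lt w j x : (j < L * m)%N -> (lsh_hash w j x < L * B.+1)%N.
Proof.
move=> jL; have lL : (j %/ m < L)%N by rewrite ltn_divLR.
rewrite /lsh_hash insubT /=; apply: (@leq_trans (j %/ m * B.+1 + B.+1)).
  by rewrite ltn_add2l.
by rewrite -mulSnr leq_mul2r lL orbT.
Qed.

Lemma lsh_hash_eq w (l l' : 'I_L) (s s' : 'I_m) x y :
  (lsh_hash w (l * m + s) x == lsh_hash w (l' * m + s') y) =
  (l == l') && collide x s y s' (w l).
Proof.
rewrite !lsh_hashE /collide; apply/eqP/andP => [e|[/eqP <- /eqP ->] //].
have key_lt (a c : 'I_B.+1) (l1 l2 : nat) : (l1 * B.+1 + a = l2 * B.+1 + c)%N ->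
    l1 = l2 /\ a = c.
  move=> e'; have := congr1 (divn^~ B.+1) e'; have := congr1 (modn^~ B.+1) e'.
  rewrite /= !modnMDl !divnMDl // !modn_small // !divn_small // !addn0.
  by move=> /val_inj -> ->.
have [ll kk] := key_lt _ _ _ _ e.
by have l_eq := val_inj ll; rewrite -l_eq in kk *; rewrite eqxx kk.
Qed.

Lemma sum_ord_pairs (F : nat -> nat) :
  (\sum_(j < L * m) F j = \sum_(l < L) \sum_(s < m) F (l * m + s))%N.
Proof.
elim: L => [|n IH]; first by rewrite !big_ord0.
by rewrite big_ord_recr -IH mulSnr big_split_ord.
Qed.

(** The near pair is missed with probability at most 1/4 and there are too many far collisions with
    probability at most 1/2; the union bound leaves 1/4. *)
Lemma lsh_success (n : nat) (x : 'I_n -> T) (far : pred 'I_n) (y : T)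
    (i0 : 'I_n) (s0 s0' : 'I_m) (q1 q2 : R) :
  (0 < n)%N -> (0 < L)%N -> 0 <= q1 -> 0 <= q2 ->
  q1 <= agree (x i0) s0 y s0' -> 3 <= L%:R * q1 ^+ k ->
  (forall i s s', far i -> agree (x i) s y s' <= q2) ->
  (n * m)%N%:R * (q2 ^+ k + B.+1%:R^-1) <= 3 ->
  exists good : pred {ffun 'I_L -> table_seed}, 4^-1 <= fraction R good /\
    forall w, good w ->
      (exists j j' : 'I_(L * m), lsh_hash w j (x i0) = lsh_hash w j' y) /\
      (\sum_(j' < L * m) \sum_(i < n) \sum_(j < L * m)
         (far i && (lsh_hash w j (x i) == lsh_hash w j' y)) < 6 * (L * m))%N.
Proof.
move=> n0 L0 q10 q20 near Lq far_le Nq.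
pose p1 (w : {ffun 'I_L -> table_seed}) := [exists l, collide (x i0) s0 y s0' (w l)].
pose f (w : {ffun 'I_L -> table_seed}) := (\sum_(l < L) \sum_(s' < m) \sum_(i < n | far i) \sum_(s < m)
  collide (x i) s y s' (w l))%N.
pose p2 w := (f w < 6 * (L * m))%N.
have Om0 : (0 < #|{: {ffun 'I_L -> table_seed}}|)%N.
  by rewrite card_ffun expn_gt0 card_table_seed_gt0.
exists (predI p1 p2); split.
  have miss : fraction R (predC p1) <= 4^-1.
    have t1 : q1 ^+ k <= fraction R (collide (x i0) s0 y s0').
      apply: le_trans (fraction_collide_ge _ _ _ _).
      by rewrite lerXn2r ?nnegrE // fraction_ge0.
    set t := fraction R _ in t1.
    have -> : fraction R (predC p1) = (1 - t) ^+ L.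
      rewrite /t -fractionC ?card_table_seed_gt0 // -[L in _ ^+ L]card_ord -fraction_all.
      congr (_%:R / _); apply: eq_card => w.
      by rewrite !unfold_in /= /p1 negb_exists.
    have t0 : 0 <= t := fraction_ge0 _; have t_le1 : t <= 1 := fraction_le1 _.
    (* Bernoulli's inequality for 1 + t, with (1 - t) (1 + t) <= 1. As L t >= 3, the probability of
       a miss in every table is at most 1/4. *)
    have bern : (1 - t) ^+ L * (1 + L%:R * t) <= 1.
      apply: (@le_trans _ _ ((1 - t) ^+ L * (1 + t) ^+ L)).
        rewrite ler_wpM2l ?exprn_ge0 ?subr_ge0 //.
        elim: (L) => [|j IH]; first by rewrite mul0r addr0.
        rewrite exprS; apply: (@le_trans _ _ ((1 + t) * (1 + j%:R * t))); last first.
          by rewrite ler_wpM2l // addr_ge0.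
        have : 0 <= j%:R * t * t.
          by apply: mulr_ge0 => //; apply: mulr_ge0 => //; rewrite ler0n.
        by rewrite -natr1; lra.
      rewrite -exprMn (_ : (1 - t) * (1 + t) = 1 - t ^+ 2); last by ring.
      rewrite exprn_ile1 ?subr_ge0 ?exprn_ile1 // lerBlDr lerDl.
      exact: exprn_ge0.
    have Lt : 3 <= L%:R * t by apply: le_trans Lq _; rewrite ler_wpM2l ?ler0n.
    have : (1 - t) ^+ L * 4 <= 1.
      apply: le_trans bern; rewrite ler_wpM2l ?exprn_ge0 ?subr_ge0 //; lra.
    lra.
  (* Each table and query slide has at most 3 far collisions on average, so the total mean is at
     most 3 L m, and Markov's inequality at 6 L m gives 1/2. *)
  have many : fraction R (predC p2) <= 2^-1.
    have c0 : (0 < 6 * (L * m))%N by rewrite !muln_gt0 L0 m_gt0.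
    have -> : fraction R (predC p2) = fraction R (fun w => 6 * (L * m) <= f w)%N.
      by congr (_%:R / _); apply: eq_card => w; rewrite !unfold_in /= /p2 -leqNgt.
    apply: le_trans (markov (mu := 3 * (L * m)%N%:R) c0 _) _; last first.
      rewrite ler_pdivrMr ?ltr0n // natrM; lra.
    rewrite natr_sum mulr_suml.
    have -> : \sum_w (f w)%:R / #|{: {ffun 'I_L -> table_seed}}|%:R =
        \sum_(l < L) \sum_(s' < m) \sum_(i < n | far i) \sum_(s < m)
          fraction R (collide (x i) s y s') :> R.
      rewrite -mulr_suml /f.
      under eq_bigr do rewrite natr_sum.
      rewrite exchange_big mulr_suml; apply: eq_bigr => l _.
      under eq_bigr do rewrite natr_sum.
      rewrite exchange_big mulr_suml; apply: eq_bigr => s' _.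
      under eq_bigr do rewrite natr_sum.
      rewrite exchange_big mulr_suml; apply: eq_bigr => i _.
      under eq_bigr do rewrite natr_sum.
      rewrite exchange_big mulr_suml; apply: eq_bigr => s _.
      by rewrite -fraction_sum (fraction_coord card_table_seed_gt0).
    have q2B : 0 <= q2 ^+ k + B.+1%:R^-1 by rewrite addr_ge0 ?exprn_ge0 ?invr_ge0 ?ler0n.
    have inner : \sum_(i < n | far i) \sum_(s < m) (q2 ^+ k + B.+1%:R^-1) <= 3 :> R.
      apply: le_trans Nq; rewrite big_mkcond /=.
      apply: (@le_trans _ _ (\sum_(i < n) \sum_(s < m) (q2 ^+ k + B.+1%:R^-1))).
        by apply: ler_sum => i _; case: ifP => // _; apply: sumr_ge0.
      by rewrite !sumr_const !card_ord -mulrnA mulnC mulr_natl.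
    apply: (@le_trans _ _ (\sum_(l < L) \sum_(s' < m) 3)); last first.
      by rewrite !sumr_const !card_ord -mulrnA mulnC mulr_natr.
    apply: ler_sum => l _; apply: ler_sum => s' _; apply: le_trans inner.
    apply: ler_sum => i fi; apply: ler_sum => s _.
    apply: le_trans (fraction_collide_le _ _ _ _) _.
    by rewrite lerD2r lerXn2r ?nnegrE ?fraction_ge0 ?far_le // (le_trans (fraction_ge0 _) (far_le i s s' fi)).
  apply: le_trans (fraction_and Om0 miss many); lra.
move=> w /andP[/existsP[l0 col] fw]; split.
  have lt1 (s : 'I_m) : (l0 * m + s < L * m)%N.
    apply: (@leq_trans (l0 * m + m)); first by rewrite ltn_add2l.
    by rewrite -mulSnr leq_mul2r ltn_ord orbT.
  exists (Ordinal (lt1 s0)), (Ordinal (lt1 s0')); apply/eqP.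
  by rewrite lsh_hash_eq eqxx.
apply: leq_trans fw; rewrite ltnS /f.
rewrite (sum_ord_pairs (fun j' => \sum_(i < n) \sum_(j < L * m)
  (far i && (lsh_hash w j (x i) == lsh_hash w j' y)))%N).
apply: leq_sum => l _; apply: leq_sum => s' _.
rewrite [leqRHS]big_mkcond /=; apply: leq_sum => i _.
rewrite (sum_ord_pairs (fun j => far i && (lsh_hash w j (x i) == lsh_hash w (l * m + s') y) : nat)).
case: (far i) => /=; last by rewrite big1 // => *; rewrite big1.
rewrite (bigD1 l) //= [X in (_ + X)%N]big1 ?addn0; last first.
  by move=> l' ne; rewrite big1 // => s _; rewrite lsh_hash_eq (negbTE ne).
by apply: leq_sum => s _; rewrite lsh_hash_eq eqxx.
Qed.

End Tables.
End Fraction.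

(** * Turning functions on a grid *)

Section Cells.
Context {R : realType}.
Notation mu := (@lebesgue_measure R).
Variable M : nat.
Hypothesis M_gt0 : (0 < M)%N.
Implicit Types d : nat -> R.

Definition cell (i : nat) : set R := `[i%:R / M%:R, i.+1%:R / M%:R[.

Lemma in_cell i (x : R) : 0 <= x -> cell i x <-> Num.truncn (M%:R * x) = i.
Proof.
move=> x0; rewrite /cell /= in_itv /= ler_pdivrMr ?(gt0_natr R M_gt0) // ltr_pdivlMr ?(gt0_natr R M_gt0) //.
rewrite [x * _]mulrC; split=> [/truncn_def //|<-].
by rewrite truncn_itv // mulr_ge0 // ler0n.
Qed.

Definition cellwise d (x : R) : R := \sum_(i < M) d i * \1_(cell i) x.

Lemma truncn_lt_M (x : R) : 0 <= x < 1 -> (Num.truncn (M%:R * x)%R < M)%N.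
Proof.
move=> /andP[x0 x1]; rewrite truncn_lt_nat ?mulr_ge0 ?ler0n //.
by rewrite gtr_pMr ?(gt0_natr R M_gt0).
Qed.

Lemma cellwiseE d (x : R) : 0 <= x < 1 -> cellwise d x = d (Num.truncn (M%:R * x)).
Proof.
move=> x01; have /andP[x0 _] := x01.
rewrite /cellwise (bigD1 (Ordinal (truncn_lt_M x01))) //= big1 ?addr0.
  by rewrite indicE mem_set ?mulr1 //; apply/in_cell.
move=> i ne; rewrite indicE memNset ?mulr0 // => /(in_cell _ x0) e.
by move/eqP: ne; apply; apply: val_inj; rewrite /= e.
Qed.

Lemma measurable_cellwise d D : measurable_fun D (cellwise d).
Proof.
apply: measurable_sum => i; apply: measurable_funM; first exact: measurable_cst.
by apply: measurable_indic; apply: measurable_itv.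
Qed.

Lemma integral_cellwise d : (forall i, 0 <= d i) ->
  (\int[mu]_(x in `[0%R, 1%R[) (cellwise d x)%:E = ((\sum_(i < M) d i) / M%:R)%:E)%E.
Proof.
move=> d0; rewrite /cellwise.
under eq_integral do rewrite -sumEFin.
rewrite ge0_integral_sum //=; last 2 first.
- move=> i; apply/measurable_EFinP/measurable_funM; first exact: measurable_cst.
  by apply: measurable_indic; apply: measurable_itv.
- by move=> i x _; rewrite lee_fin mulr_ge0 // indicE ler0n.
rewrite mulr_suml -sumEFin; apply: eq_bigr => i _.
under eq_integral do rewrite EFinM.
rewrite ge0_integralZl_EFin //=; last first.
  by apply/measurable_EFinP; apply: measurable_indic; apply: measurable_itv.
rewrite integral_indic //; last exact: measurable_itv.
rewrite setIidl; last first.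
  move=> x; rewrite /cell /= !in_itv /= => /andP[x1 x2].
  rewrite (le_trans _ x1) ?divr_ge0 ?ler0n //= (lt_le_trans x2) //.
  by rewrite ler_pdivrMr ?(gt0_natr R M_gt0) // mul1r ler_nat.
rewrite EFinM; congr (_ * _)%E; rewrite [LHS]lebesgue_measure_itv /= lte_fin.
rewrite ltr_pM2r ?invr_gt0 ?(gt0_natr R M_gt0) // ltr_nat ltnSn.
by rewrite -EFinD -mulrBl -natrB // subSnn mul1r.
Qed.

(** The integral is squeezed between those of two cellwise constant functions. The lower one is cut
    off at 0, so that monotonicity for nonnegative functions applies, and the two finite bounds
    exclude an infinite integral. *)
Lemma Rintegral_cells (phi : R -> R) (c : nat -> R) (bad : pred nat) (K : R) :
  measurable_fun setT phi -> (forall x, 0 <= phi x) -> (forall i, 0 <= c i) ->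
  0 <= K ->
  (forall x, 0 <= x < 1 -> let i := Num.truncn (M%:R * x) in
     `|phi x - c i| <= K * (bad i)%:R) ->
  `| \int[mu]_(x in `[0%R, 1%R]) phi x - (\sum_(i < M) c i) / M%:R |
    <= K * (\sum_(i < M) bad i)%:R / M%:R.
Proof.
move=> mphi phi0 c0 K0 close.
have mphi' : measurable_fun (`[0%R, 1%R[%classic : set R) (EFin \o phi).
  by apply/measurable_EFinP; apply: measurable_funTS.
have in01 (x : R) : (`[0%R, 1%R[%classic : set R) x -> 0 <= x < 1.
  by rewrite /= in_itv.
pose lo i := Num.max 0 (c i - K * (bad i)%:R).
pose hi i := c i + K * (bad i)%:R.
have lo0 i : 0 <= lo i by rewrite /lo le_max lexx.
have hi0 i : 0 <= hi i by rewrite addr_ge0 // mulr_ge0.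
have ub : (\int[mu]_(x in `[0%R, 1%R[) (phi x)%:E <= ((\sum_(i < M) hi i) / M%:R)%:E)%E.
  rewrite -(integral_cellwise hi0); apply: ge0_le_integral => //=.
  - by move=> x _; rewrite lee_fin.
  - by apply/measurable_EFinP; apply: measurable_cellwise.
  move=> x /in01 x01; rewrite lee_fin cellwiseE // /hi.
  by have := close x x01; rewrite /= ler_norml => /andP[_]; lra.
have lb : (((\sum_(i < M) lo i) / M%:R)%:E <= \int[mu]_(x in `[0%R, 1%R[) (phi x)%:E)%E.
  rewrite -(integral_cellwise lo0); apply: ge0_le_integral => //=.
  - by move=> x /in01 x01; rewrite lee_fin cellwiseE.
  - by apply/measurable_EFinP; apply: measurable_cellwise.
  move=> x /in01 x01; rewrite lee_fin cellwiseE // /lo ge_max phi0 /=.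
  by have := close x x01; rewrite /= ler_norml => /andP[]; lra.
rewrite /Rintegral -integral_itv_bndo_bndc //.
move: ub lb; case: (\int[mu]_(x in _) _)%E => [I| |] //=; rewrite !lee_fin => ub lb.
have lo_le : (\sum_(i < M) c i) / M%:R - K * (\sum_(i < M) bad i)%:R / M%:R
    <= (\sum_(i < M) lo i) / M%:R.
  rewrite -mulrBl ler_pM2r ?invr_gt0 ?(gt0_natr R M_gt0) // natr_sum mulr_sumr -sumrB.
  by apply: ler_sum => i _; rewrite /lo le_max lexx orbT.
have hi_ge : (\sum_(i < M) hi i) / M%:R =
    (\sum_(i < M) c i) / M%:R + K * (\sum_(i < M) bad i)%:R / M%:R.
  by rewrite -mulrDl natr_sum mulr_sumr -big_split.
rewrite ler_norml; lra.
Qed.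

End Cells.

(** * Bounds on turning angles and on positions of vertices *)

Section TurningBounds.
Context {R : realType}.
Implicit Types P Q : polygon R.

(* [acos] is 0 outside [-1, 1]. *)
Lemma acos_range (x : R) : 0 <= acos x <= pi.
Proof.
have [x1|nx] := boolP (-1 <= x <= 1); first by rewrite acos_ge0 // acos_lepi.
rewrite unlock /=; case: xgetP => [y _ [/andP[-> ->]] //|_].
by rewrite lexx pi_ge0.
Qed.

Lemma norm_turn_le P i : `|turn P i| <= pi.
Proof.
rewrite /turn /signed_angle normrM; have /andP[a0 api] := acos_range
  (dot (edge P (i + (size P).-1)) (edge P i) /
   (vnorm (edge P (i + (size P).-1)) * vnorm (edge P i))).
rewrite [X in _ * X]ger0_norm // -[leRHS]mul1r ler_pM //.
by rewrite normr_sg lern1 leq_b1.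
Qed.

Lemma vnorm_ge0 (v : R * R) : 0 <= vnorm v. Proof. exact: sqrtr_ge0. Qed.

Lemma arc_pos_range P i : (i <= size P)%N -> 0 <= arc_pos P i <= 1.
Proof.
move=> ip; have s0 (k : nat) : 0 <= \sum_(j < k) vnorm (edge P j).
  by apply: sumr_ge0 => *; exact: vnorm_ge0.
rewrite /arc_pos divr_ge0 ?s0 //=.
have [->|per0] := eqVneq (perimeter P) 0; first by rewrite invr0 mulr0.
have per_gt0 : 0 < perimeter P by rewrite lt_def per0 s0.
rewrite ler_pdivrMr // mul1r /perimeter (big_ord_widen _ (fun j => vnorm (edge P j)) ip).
rewrite big_mkcond; apply: ler_sum => j _; case: ifP => // _; exact: vnorm_ge0.
Qed.

Lemma arc_from_ref_range P i : (i <= size P)%N -> 0 < arc_from_ref P i <= 1.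
Proof.
move=> ip; have /andP[a0 a1] := arc_pos_range ip; have /andP[r0 r1] := polygon_ref P.
by rewrite /arc_from_ref; case: (ltP (ref_pos P)) => ra; apply/andP; split; lra.
Qed.

(* Subtracting the full turn 2 pi bounds the sum over a subset by the sum over
   its complement. *)
Lemma subset_turn_le P (B : pred 'I_(size P)) m : (size P <= m)%N ->
  `|\sum_(i | B i) turn P i| <= (m./2 + 1)%:R * pi.
Proof.
move=> pm; have pi0 := pi_ge0 R.
have bound (A : pred 'I_(size P)) : `|\sum_(i | A i) turn P i| <= #|A|%:R * pi.
  apply: le_trans (ler_norm_sum _ _ _) _.
  rewrite mulr_natl -sumr_const; apply: ler_sum => i _; exact: norm_turn_le.
have total : \sum_(i | B i) turn P i + \sum_(i | ~~ B i) turn P i = 2 * pi.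
  by rewrite -(polygon_ccw P) [RHS](bigID B).
have b1 := bound B; have b2 := bound (predC B).
have cE : (#|B| + #|predC B|)%N = size P by rewrite cardC card_ord.
have [small|large] := leqP #|B| (m./2 + 1).
  by apply: le_trans b1 _; rewrite ler_wpM2r // ler_nat.
(* When [B] has more than [m./2 + 1] elements, its complement has at most [m./2 - 1], which leaves
   room for the full turn. *)
have large' : (#|predC B| + 2 <= m./2 + 1)%N.
  have aux (x y z : nat) : (x + y = z -> m./2 + 1 < x -> z <= m -> y + 2 <= m./2 + 1)%N.
    by move=> *; have := odd_double_half m; case: (odd m); lia.
  exact: aux cE large pm.
have : #|predC B|%:R * pi + 2 * pi <= (m./2 + 1)%:R * pi :> R.
  by rewrite -mulrDl ler_wpM2r // -natrD ler_nat.
move: b1 b2; rewrite !ler_norml => /andP[? ?] /andP[].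
rewrite (eq_bigl (fun i => ~~ B i)) // => ? ? ?; apply/andP; split; lra.
Qed.

End TurningBounds.

(** * Sampling turning functions *)

Section GridTurning.
Context {R : realType}.
Variable M : nat.
Hypothesis M_gt0 : (0 < M)%N.
Implicit Types P Q : polygon R.

(** Rounding up moves a breakpoint to the first grid point not before it, so that [gridfun P a] is
    the extended turning function at a / M for a < 2 M. *)
Definition grid_pos P (i : nat) : nat := `|Num.ceil (M%:R * arc_from_ref P i)|%N.

Definition gridfun P : nat -> R :=
  stepfun M (direction (edge P (ref_edge P))) (fun i : 'I_(size P) => turn P i)
    (fun i : 'I_(size P) => grid_pos P i).

Lemma grid_pos_leE P i a : (i <= size P)%N ->
  (grid_pos P i <= a)%N = (M%:R * arc_from_ref P i <= a%:R).
Proof.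
move=> ip; have /andP[b0 b1] := arc_from_ref_range ip.
rewrite -[a%:R]/(a%:Z%:~R) -ceil_le_int -lez_nat /grid_pos gez0_abs //.
by rewrite ltW // ceil_gt0 mulr_gt0 // ltr0n.
Qed.

Lemma grid_pos_range P i : (i <= size P)%N -> (0 < grid_pos P i <= M)%N.
Proof.
move=> ip; have /andP[b0 b1] := arc_from_ref_range ip.
rewrite ltnNge !grid_pos_leE // -ltNge mulr_gt0 ?ltr0n //=.
by rewrite ler_piMr ?ler0n.
Qed.

Lemma gridfun_quasiperiodic P : quasiperiodic M (2 * pi) (gridfun P).
Proof.
apply: stepfun_quasiperiodic => //; last exact: polygon_ccw.
by move=> i; apply: grid_pos_range; apply: ltnW.
Qed.

Lemma gridfunE P a : (a < 2 * M)%N ->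
  gridfun P a = direction (edge P (ref_edge P)) +
    \sum_(i < size P) turn P i * ((grid_pos P i <= a) + (grid_pos P i + M <= a))%N%:R.
Proof.
move=> aM; congr (_ + _); apply: eq_bigr => i _; congr (_ * _%:R).
have /andP[b0 bM] := grid_pos_range (ltnW (ltn_ord i)).
set b := grid_pos P i in b0 bM *.
case: (leqP b a) => [ba|ab]; last first.
  by rewrite leqNgt (leq_trans ab) ?leq_addr //= divn_small //; lia.
case: (leqP (b + M) a) => [bMa|abM] /=.
  rewrite (_ : a + M - b = 2 * M + (a - M - b))%N; last by lia.
  by rewrite divnMDl // divn_small ?addn0 //; lia.
rewrite (_ : a + M - b = 1 * M + (a - b))%N; last by lia.
by rewrite divnMDl // divn_small ?addn0 //; lia.
Qed.

(** The increment 2 pi of the extension is the total turning, so it amounts to counting every vertex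
    again one period later. *)
Lemma ext2pi_turningE P (y : R) : 0 <= y < 2 ->
  ext2pi (turning P) y = direction (edge P (ref_edge P)) +
    \sum_(i < size P) turn P i *
      ((arc_from_ref P i <= y)%R + (arc_from_ref P i + 1 <= y)%R)%N%:R.
Proof.
move=> /andP[y0 y2]; rewrite /ext2pi /turning; case: leP => y1.
  congr (_ + _); rewrite big_mkcond; apply: eq_bigr => i _.
  have /andP[b0 b1] := arc_from_ref_range (ltnW (ltn_ord i)).
  rewrite [X in (_ + nat_of_bool X)%N](_ : _ = false); last by apply/negbTE; rewrite -ltNge; lra.
  by case: leP; rewrite ?mulr0 ?mulr1.
rewrite -addrA -(polygon_ccw P) big_mkcond -big_split /=; congr (_ + _).
apply: eq_bigr => i _; have /andP[b0 b1] := arc_from_ref_range (ltnW (ltn_ord i)).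
rewrite [X in (nat_of_bool X + _)%N](_ : _ = true); last by apply/idP; lra.
by rewrite lerBrDr natrD mulrDr mulr1 addrC; case: leP; rewrite ?mulr0 ?mulr1.
Qed.

(** A breakpoint past the left end of the cell of [y], and not after [y], would be rounded to the
    right end of that cell, which the hypothesis excludes modulo the period. *)
Lemma ext2pi_gridfun P (y : R) : 0 <= y < 2 ->
  (forall i : 'I_(size P), grid_pos P i != (Num.truncn (M%:R * y)).+1 %[mod M]) ->
  ext2pi (turning P) y = gridfun P (Num.truncn (M%:R * y)).
Proof.
move=> y02 nj; have /andP[y0 y2] := y02.
have My0 : 0 <= M%:R * y by rewrite mulr_ge0.
have MR := gt0_natr R M_gt0 : 0 < M%:R :> R.
have aM : (Num.truncn (M%:R * y) < 2 * M)%N.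
  by rewrite truncn_lt_nat // natrM mulrC ltr_pM2r.
rewrite ext2pi_turningE // gridfunE //; congr (_ + _).
have /andP[] := truncn_itv My0; set a := Num.truncn _ in nj * => ay ya.
apply: eq_bigr => i _; congr (_ * (nat_of_bool _ + nat_of_bool _)%N%:R).
- apply/idP/idP => [by_|]; last first.
    by rewrite grid_pos_leE ?(ltnW (ltn_ord i)) // => /le_trans/(_ ay); rewrite ler_pM2l.
  have : (grid_pos P i <= a.+1)%N.
    rewrite grid_pos_leE ?(ltnW (ltn_ord i)) //; apply: le_trans (ltW ya).
    by rewrite ler_pM2l.
  rewrite leq_eqVlt => /orP[/eqP e|//]; by have := nj i; rewrite e eqxx.
- have shiftE c : (grid_pos P i + M <= c)%N = (M%:R * (arc_from_ref P i + 1) <= c%:R).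
    rewrite mulrDr mulr1; case: (leqP M c) => Mc.
      rewrite -{1}(subnK Mc) leq_add2r grid_pos_leE ?(ltnW (ltn_ord i)) //.
      by rewrite natrB // lerBrDr.
    rewrite leqNgt (leq_trans Mc) ?leq_addl //; apply/esym/negbTE; rewrite -ltNge.
    have /andP[b0 b1] := arc_from_ref_range (ltnW (ltn_ord i)).
    apply: (@lt_le_trans _ _ M%:R); first by rewrite ltr_nat.
    by rewrite lerDr mulr_ge0 ?ltW.
  apply/idP/idP => [by_|]; last first.
    by rewrite shiftE => /le_trans/(_ ay); rewrite ler_pM2l.
  have : (grid_pos P i + M <= a.+1)%N.
    by rewrite shiftE; apply: le_trans (ltW ya); rewrite ler_pM2l.
  rewrite leq_eqVlt => /orP[/eqP e|//]; have := nj i.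
  by rewrite -e modnDr eqxx.
Qed.

Lemma sum_turn_le P (k : 'I_(size P) -> nat) : (forall i, k i <= 2)%N ->
  `|\sum_(i < size P) turn P i * (k i)%:R| <= 2 * (size P)%:R * pi.
Proof.
move=> k2; apply: le_trans (ler_norm_sum _ _ _) _.
rewrite -mulrA mulrCA mulr_natl -[X in _ *+ X]card_ord -sumr_const.
apply: ler_sum => i _; rewrite normrM normr_nat mulrC.
by apply: ler_pM => //; [rewrite ler_nat|exact: norm_turn_le].
Qed.

(** A crude bound for the exceptional cells: in each of the two sums every vertex counts at most
    twice, with an angle of at most pi. *)
Lemma ext2pi_near_gridfun P (y : R) a : 0 <= y < 2 -> (a < 2 * M)%N ->
  `|ext2pi (turning P) y - gridfun P a| <= 4 * (size P)%:R * pi.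
Proof.
move=> y02 aM; rewrite ext2pi_turningE // gridfunE // opprD addrACA subrr add0r.
apply: le_trans (ler_normB _ _) _.
apply: le_trans (lerD (sum_turn_le _) (sum_turn_le _)) _.
- by move=> i; do 2 case: (_ <= _).
- by move=> i; case: (grid_pos P i <= a)%N; case: (grid_pos P i + M <= a)%N.
lra.
Qed.

Lemma measurable_turning P : measurable_fun setT (turning P).
Proof.
apply: measurable_funD; first exact: measurable_cst.
under eq_fun do rewrite big_mkcond.
apply: measurable_sum => i; apply: measurable_fun_if => //.
by apply: measurable_fun_ler.
Qed.

Lemma measurable_ext2pi (f : R -> R) : measurable_fun setT f ->
  measurable_fun setT (ext2pi f).
Proof.
move=> mf; apply: measurable_fun_if => //.
- exact: measurable_fun_ler.
- exact: measurable_funTS.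
apply: measurable_funD => //; apply: measurable_funTS.
by apply: (measurableT_comp mf); apply: measurable_funB.
Qed.

End GridTurning.

(** * Grid approximation of the distance *)

Section GridDistance.
Context {R : realType}.
Implicit Types P Q : polygon R.

Lemma sum_congr_le1 (M b s : nat) : (0 < M)%N ->
  (\sum_(i < M) (b == i + s %[mod M]) <= 1)%N.
Proof.
move=> M_gt0; rewrite -big_mkcond /= sum1_card; apply/card_le1_eqP => i j.
rewrite !unfold_in => /eqP bi /eqP bj; apply: val_inj => /=.
have /eqP : (i + s = j + s %[mod M])%N by rewrite -bi.
by rewrite eqn_modDr !modn_small // => /eqP.
Qed.

(* At most 3 m cells contain or precede a breakpoint, and on these the integrand
   is off by at most 8 pi m. *)
Definition grid_error (m : nat) : R := 24 * pi * m%:R ^+ 2.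

(** For x in cell i, the point x + u is in cell i + j or i + j + 1. A cell i is bad if a breakpoint
    of [P] rounds to the right end of one of these, or one of [Q] to the right end of cell i; on the
    other cells the integrand equals its grid value. *)
Lemma D1_integral_grid P Q m M u alpha : (0 < M)%N ->
  (size P <= m)%N -> (size Q <= m)%N -> 0 <= u <= 1 ->
  `|\int[lebesgue_measure]_(x in `[0%R, 1%R])
      `|ext2pi (turning P) (x + u) + alpha - turning Q x|
    - gap M (gridfun M P) (gridfun M Q) alpha (Num.truncn (M%:R * u)) / M%:R|
  <= grid_error m / M%:R.
Proof.
move=> M_gt0 Pm Qm /andP[u0 u1]; set j := Num.truncn _.
have MR := gt0_natr R M_gt0 : 0 < M%:R :> R.
have pi0 := pi_ge0 R.
have Mu0 : 0 <= M%:R * u by rewrite mulr_ge0.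
have /andP[ju uj] := truncn_itv Mu0; rewrite -/j in ju uj.
have jM : (j <= M)%N.
  by rewrite -(ler_nat R); apply: le_trans ju _; rewrite ler_piMr.
pose badP s i := [exists k : 'I_(size P), grid_pos M P k == i + s %[mod M]].
pose badQ i := [exists k : 'I_(size Q), grid_pos M Q k == i + 1 %[mod M]].
pose bad i := [|| badP j.+1 i, badP j.+2 i | badQ i].
apply: (@le_trans _ _ ((8 * m%:R * pi) * (\sum_(i < M) bad i)%:R / M%:R)); last first.
  rewrite ler_pM2r ?invr_gt0 // (_ : grid_error m = (8 * m%:R * pi) * (3 * m)%N%:R); last first.
    by rewrite /grid_error natrM; ring.
  rewrite ler_wpM2l ?mulr_ge0 ?ler0n // ler_nat.
  have exle (p : nat) (f : 'I_p -> nat) s : (p <= m)%N ->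
      (\sum_(i < M) [exists k, f k == i + s %[mod M]] <= m)%N.
    move=> pm; apply: (@leq_trans (\sum_(i < M) \sum_(k < p) (f k == i + s %[mod M]))).
      apply: leq_sum => i _; case: existsP => // -[k fk].
      by rewrite (bigD1 k) //= fk.
    rewrite exchange_big /=; apply: (@leq_trans (\sum_(k < p) 1)).
      by apply: leq_sum => k _; exact: sum_congr_le1.
    by rewrite sum1_card card_ord.
  apply: (@leq_trans (\sum_(i < M) (badP j.+1 i + badP j.+2 i + badQ i))).
    by apply: leq_sum => i _; rewrite /bad; case: (badP j.+1 i); case: (badP j.+2 i); case: (badQ i).
  rewrite !big_split /= mulSn mulSn mul1n addnA.
  by rewrite !leq_add ?exle.
apply: (@Rintegral_cells R M M_gt0
  (fun x => `|ext2pi (turning P) (x + u) + alpha - turning Q x|)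
  (fun i => `|gridfun M P (i + j)%N + alpha - gridfun M Q i|) bad).
- apply: measurableT_comp => //; apply: measurable_funB; last exact: measurable_turning.
  apply: measurable_funD => //.
  have mP := measurable_ext2pi (measurable_turning P).
  by apply: (measurableT_comp mP); apply: measurable_funD.
- by move=> x.
- by move=> i.
- by rewrite !mulr_ge0.
move=> x x01; have /andP[x0 x1] := x01; set i := Num.truncn _; cbv zeta.
have Mx0 : 0 <= M%:R * x by rewrite mulr_ge0.
have /andP[ix xi] := truncn_itv Mx0; rewrite -/i in ix xi.
have iM : (i < M)%N := truncn_lt_M M_gt0 x01.
have y02 : 0 <= x + u < 2 by apply/andP; split; lra.
have x02 : 0 <= x < 2 by apply/andP; split; lra.
have -> : turning Q x = ext2pi (turning Q) x by rewrite /ext2pi ltW.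
have ijM : (i + j < 2 * M)%N by rewrite mul2n -addnn -addSn leq_add.
apply: le_trans (ler_dist_dist _ _) _.
have -> : ext2pi (turning P) (x + u) + alpha - ext2pi (turning Q) x -
    (gridfun M P (i + j)%N + alpha - gridfun M Q i) =
    (ext2pi (turning P) (x + u) - gridfun M P (i + j)%N) -
    (ext2pi (turning Q) x - gridfun M Q i) by ring.
have [hb|] := boolP (bad i).
  rewrite mulr1; apply: le_trans (ler_normB _ _) _.
  have iM2 : (i < 2 * M)%N by apply: leq_trans iM _; rewrite leq_pmull.
  have le1 := ext2pi_near_gridfun M_gt0 P y02 ijM.
  have le2 := ext2pi_near_gridfun M_gt0 Q x02 iM2.
  have le3 : 4 * (size P)%:R * pi <= 4 * m%:R * pi :> R.
    by rewrite ler_wpM2r // ler_pM2l // ler_nat.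
  have le4 : 4 * (size Q)%:R * pi <= 4 * m%:R * pi :> R.
    by rewrite ler_wpM2r // ler_pM2l // ler_nat.
  lra.
rewrite !negb_or !negb_exists => /and3P[/forallP n1 /forallP n2 /forallP n3].
rewrite mulr0 -[X in X - _](_ : 0 = _).
  rewrite -[X in _ - X](_ : 0 = _) ?subrr ?normr0 //.
  by rewrite (ext2pi_gridfun M_gt0) ?subrr // => k; rewrite -addn1; exact: n3.
set a := Num.truncn (M%:R * (x + u)).
have My0 : 0 <= M%:R * (x + u) by rewrite mulr_ge0 ?addr_ge0.
have /andP[ay ya] := truncn_itv My0; rewrite -/a mulrDr in ay ya.
(* No breakpoint rounds to i + j + 1, so both cells in which x + u may lie carry the same value. *)
have jumpij : gridfun M P (i + j).+1 = gridfun M P (i + j)%N.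
  apply: stepfun_jump => [//|k|k]; first by apply: grid_pos_range => //; apply: ltnW.
  by rewrite -addnS; exact: n1.
have [aE|aE] : a = (i + j)%N \/ a = (i + j).+1.
  have l1 : (i + j < a.+1)%N.
    by rewrite -(ltr_nat R) natrD; apply: le_lt_trans ya; apply: lerD.
  have l2 : (a < (i + j).+2)%N.
    rewrite -(ltr_nat R); apply: le_lt_trans ay _.
    by rewrite -addSn -addnS natrD; apply: ltrD.
  by clearbody a i j; clear - l1 l2; lia.
- rewrite (ext2pi_gridfun M_gt0) // -/a aE ?subrr // => k; rewrite -addnS; exact: n1.
rewrite (ext2pi_gridfun M_gt0) // -/a aE ?jumpij ?subrr // => k.
by rewrite -!addnS; exact: n2.
Qed.

Let values P Q : set R := [set d : R | exists alpha u : R, 0 <= u <= 1 /\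
    d = \int[lebesgue_measure]_(x in `[0%R, 1%R])
           `| ext2pi (turning P) (x + u) + alpha - turning Q x |].

Lemma values_ge0 P Q d : values P Q d -> 0 <= d.
Proof.
by move=> [alpha [u [_ ->]]]; apply: Rintegral_ge0.
Qed.

(** The shift u / M is a grid point, so rounding returns exactly [u], and its integral is a
    competitor in the infimum. *)
Lemma polygon_dist_le_gap P Q m M u alpha : (0 < M)%N ->
  (size P <= m)%N -> (size Q <= m)%N -> (u < M)%N ->
  polygon_dist P Q <=
    (gap M (gridfun M P) (gridfun M Q) alpha u + grid_error m) / M%:R.
Proof.
move=> M_gt0 Pm Qm uM; have MR := gt0_natr R M_gt0 : 0 < M%:R :> R.
pose v : R := u%:R / M%:R.
have u01 : 0 <= v <= 1.
  apply/andP; split; first by rewrite /v divr_ge0 ?ler0n.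
  by rewrite /v ler_pdivrMr // mul1r ler_nat ltnW.
have := D1_integral_grid alpha M_gt0 Pm Qm u01.
rewrite [M%:R * _]mulrC {2}/v divfK ?gt_eqF // natrK.
set I := \int[_]_(_ in _) _ => close.
apply: (@le_trans _ _ I).
  apply: ge_inf; last by exists alpha, v.
  by exists 0 => d /values_ge0.
by move: close; rewrite mulrDl ler_norml => /andP[]; lra.
Qed.

(** The infimum is approached rather than attained here, whence the strict bound [s]. *)
Lemma exists_gap_le P Q m M s : (0 < M)%N ->
  (size P <= m)%N -> (size Q <= m)%N -> polygon_dist P Q < s ->
  exists u alpha, gap M (gridfun M P) (gridfun M Q) alpha u / M%:R <= s + grid_error m / M%:R.
Proof.
move=> M_gt0 Pm Qm ds.
have hi : has_inf (values P Q).
  split; last by exists 0 => d /values_ge0.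
  by eexists; exists 0, 0; split; [rewrite lexx ler01|reflexivity].
have [d [alpha [u [u01 dE]]] dlt] : exists2 d, values P Q d & d < s.
  have s0 : 0 < s - polygon_dist P Q by rewrite subr_gt0.
  have [d hd dlt] := inf_adherent s0 hi; exists d => //.
  by move: dlt; rewrite -[inf _]/(polygon_dist P Q); lra.
exists (Num.truncn (M%:R * u)), alpha.
have := D1_integral_grid alpha M_gt0 Pm Qm u01.
by rewrite -dE ler_norml => /andP[]; lra.
Qed.

End GridDistance.

(** * Slides and their spans *)

Section Slides.
Context {R : realType}.
Implicit Types P Q : polygon R.

Definition span_bound (m : nat) : R := lambda m / 2 + 2 * pi.

Lemma span_boundE m : span_bound m = (m./2 + 1)%:R * pi + 2 * pi.
Proof.
have e : (2 * m./2 + 2 = 2 * (m./2 + 1))%N by rewrite mulnDr.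
by rewrite /span_bound /lambda e natrM; field.
Qed.

Lemma span_bound_gt0 m : 0 < span_bound m.
Proof.
rewrite span_boundE; have := pi_gt0 R => pi0.
by rewrite addr_gt0 ?mulr_gt0 // ltr0n addn1.
Qed.

Variable M : nat.
Hypothesis M_gt0 : (0 < M)%N.

(** Two values in the same period differ by the turns at the vertices between them, and partial sums
    of turns are bounded over any set of vertices. *)
Lemma gridfun_period_span P m x y : (size P <= m)%N -> (x < M)%N -> (y < M)%N ->
  `|gridfun M P x - gridfun M P y| <= (m./2 + 1)%:R * pi.
Proof.
move=> Pm; wlog xy : x y / (y <= x)%N => [hw xM yM|xM yM].
  by case: (leqP y x) => [|/ltnW] xy; [|rewrite distrC]; exact: hw.
have range (i : 'I_(size P)) : (0 < grid_pos M P i <= M)%N.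
  by apply: grid_pos_range => //; apply: ltnW.
rewrite /gridfun !stepfunE // opprD addrACA subrr add0r.
rewrite (bigID (fun i : 'I_(size P) => grid_pos M P i <= y)%N) /=.
rewrite (eq_bigl (fun i : 'I_(size P) => grid_pos M P i <= y)%N); last first.
  by move=> i; case: (leqP (grid_pos M P i) y) => [/leq_trans-> //|_]; rewrite andbF.
by rewrite addrAC subrr add0r; exact: subset_turn_le.
Qed.

(** A window of length [M] wraps around at most once, so each of its values is one of the first
    period plus 0 or 2 pi. *)
Lemma gridfun_window_span P m b x y : (size P <= m)%N -> (b <= M)%N ->
  (x < M)%N -> (y < M)%N ->
  `|gridfun M P (x + b)%N - gridfun M P (y + b)%N| <= span_bound m.
Proof.
move=> Pm bM xM yM; have Fp := gridfun_quasiperiodic M_gt0 P.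
have pi0 := pi_ge0 R.
have reduce z : (z < M)%N -> exists z' (t : R), [/\ (z' < M)%N, 0 <= t <= 2 * pi &
    gridfun M P (z + b)%N = gridfun M P z' + t].
  move=> zM; case: (ltnP (z + b) M) => zb.
    by exists (z + b)%N, 0; rewrite zb addr0 lexx mulr_ge0.
  exists (z + b - M)%N, (2 * pi); split; last by rewrite -Fp subnK.
    by rewrite ltn_subLR // -addSn leq_add.
  by rewrite mulr_ge0 ?lexx.
have [x' [s [x'M /andP[s0 s1] ->]]] := reduce x xM.
have [y' [t [y'M /andP[t0 t1] ->]]] := reduce y yM.
have := gridfun_period_span Pm x'M y'M.
rewrite span_boundE !ler_norml => /andP[? ?]; apply/andP; split; lra.
Qed.

Definition slide P (i : nat) (x : 'I_M) : R := gridfun M P (x + grid_pos M P i)%N.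

Lemma slide_span P m i x y : (size P <= m)%N -> (i < size P)%N ->
  `|slide P i x - slide P i y| <= span_bound m.
Proof.
move=> Pm iP; apply: gridfun_window_span => //.
by have /andP[] := grid_pos_range M_gt0 (ltnW iP).
Qed.

Lemma exists_slides_near P Q m s : (size P <= m)%N -> (size Q <= m)%N ->
  polygon_dist P Q < s ->
  exists (i : 'I_(size P)) (j : 'I_(size Q)) a,
    l1 (fun x => slide P i x - slide Q j x + a) <= s + grid_error m / M%:R.
Proof.
move=> Pm Qm ds.
have [u [a le_s]] := exists_gap_le M_gt0 Pm Qm ds.
have P0 : (0 < size P)%N by apply: leq_trans (polygon_size P).
have Q0 : (0 < size Q)%N by apply: leq_trans (polygon_size Q).
have [||i [j [a' le1]]] := @exists_alignment R M (2 * pi) M_gt0 (size P)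
  (direction (edge P (ref_edge P))) (fun i : 'I_(size P) => turn P i)
  (fun i : 'I_(size P) => grid_pos M P i) (size Q)
  (direction (edge Q (ref_edge Q))) (fun i : 'I_(size Q) => turn Q i)
  (fun i : 'I_(size Q) => grid_pos M Q i) _ _
  (polygon_ccw P) (polygon_ccw Q) a u P0 Q0.
- by move=> i; apply: grid_pos_range => //; apply: ltnW.
- by move=> i; apply: grid_pos_range => //; apply: ltnW.
exists i, j, a'; apply: le_trans le_s.
by rewrite /l1 /mean ler_pM2r ?invr_gt0 ?(gt0_natr R M_gt0).
Qed.

(** Every aligned pair is a competitor in the infimum; hence all slides of far polygons are far,
    whatever the vertical translation. *)
Lemma polygon_dist_le_slides P Q m i j a : (size P <= m)%N -> (size Q <= m)%N ->
  (i < size P)%N -> (j < size Q)%N ->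
  polygon_dist P Q <= l1 (fun x => slide P i x - slide Q j x + a) + grid_error m / M%:R.
Proof.
move=> Pm Qm iP jQ.
have [||u [a' [uM e]]] := @alignment_shift R M (2 * pi) M_gt0 (size P)
  (direction (edge P (ref_edge P))) (fun i : 'I_(size P) => turn P i)
  (fun i : 'I_(size P) => grid_pos M P i) (size Q)
  (direction (edge Q (ref_edge Q))) (fun i : 'I_(size Q) => turn Q i)
  (fun i : 'I_(size Q) => grid_pos M Q i) _ _
  (polygon_ccw P) (polygon_ccw Q) (Ordinal iP) (Ordinal jQ) a.
- by move=> k; apply: grid_pos_range => //; apply: ltnW.
- by move=> k; apply: grid_pos_range => //; apply: ltnW.
apply: le_trans (polygon_dist_le_gap a' M_gt0 Pm Qm uM) _.
by rewrite /l1 /mean mulrDl lerD2r /gridfun -e.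
Qed.

End Slides.

Lemma polygon_dist_le_span (R : realType) (P Q : polygon R) m :
  (size P <= m)%N -> (size Q <= m)%N -> polygon_dist P Q <= span_bound m.
Proof.
move=> Pm Qm; apply/ler_addgt0Pr => e e0.
(* This grid makes the discretization error at most [e], which is arbitrary. *)
pose M := (Num.truncn (grid_error m / e : R)).+1.
have M_gt0 : (0 < M)%N by [].
have MR := gt0_natr R M_gt0 : 0 < M%:R :> R.
have err : grid_error m / M%:R <= e.
  by rewrite ler_pdivrMr // mulrC -ler_pdivrMr // ltW // truncnS_gt.
have P0 : (0 < size P)%N by apply: leq_trans (polygon_size P).
have Q0 : (0 < size Q)%N by apply: leq_trans (polygon_size Q).
pose F := slide P 0 : 'I_M -> R; pose G := slide Q 0 : 'I_M -> R.
(* Aligning the midpoints of the ranges leaves a difference of at most half the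
   sum of the spans. *)
have mid (f : 'I_M -> R) : (forall x y, `|f x - f y| <= span_bound m) ->
    exists c, forall x, `|f x - c| <= span_bound m / 2.
  move=> sp; pose lo := f [arg min_(x < ord0) f x]%O; pose hi := f [arg max_(x > ord0) f x]%O.
  exists ((lo + hi) / 2) => x.
  have lox : lo <= f x by rewrite /lo; case: arg_minP => // k _; apply.
  have xhi : f x <= hi by rewrite /hi; case: arg_maxP => // k _ kmax; exact: kmax.
  have := sp [arg max_(x > ord0) f x]%O [arg min_(x < ord0) f x]%O.
  rewrite -/lo -/hi !ler_norml => /andP[? ?]; apply/andP; split; lra.
have [c hc] := mid F (fun x y => slide_span M_gt0 x y Pm P0).
have [c' hc'] := mid G (fun x y => slide_span M_gt0 x y Qm Q0).
apply: le_trans (polygon_dist_le_slides M_gt0 (c' - c) Pm Qm P0 Q0) _.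
apply: lerD err; rewrite -[leRHS](mean_cst M_gt0); apply: le_mean => // x.
have -> : slide P 0 x - slide Q 0 x + (c' - c) = (F x - c) - (G x - c') by rewrite /F /G; ring.
apply: le_trans (ler_normB _ _) _; have := hc x; have := hc' x; lra.
Qed.

(** * Random threshold bits *)

Section Bits.
Context {R : realType}.

Lemma sum_ltn_xor (H a b : nat) : (a <= H)%N -> (b <= H)%N ->
  (\sum_(y < H) ((y < a) != (y < b)))%N = ((a - b) + (b - a))%N.
Proof.
wlog ab : a b / (a <= b)%N => [hw aH bH|aH bH].
  case: (leqP a b) => [|/ltnW] ab; first exact: hw.
  by rewrite addnC -hw //; apply: eq_bigr => y _; rewrite eq_sym.
have sumlt c : (c <= H)%N -> (\sum_(y < H) (y < c) = c)%N.
  by move=> cH; rewrite -big_mkcond /= -(big_ord_widen _ (fun=> 1%N) cH) sum1_card card_ord.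
have : (\sum_(y < H) ((y < a) != (y < b)) + \sum_(y < H) (y < a) = \sum_(y < H) (y < b))%N.
  rewrite -big_split; apply: eq_bigr => y _ /=.
  by case: (ltnP y a) => ya; [rewrite (leq_trans ya ab)|case: (y < b)%N].
by rewrite !sumlt //; lia.
Qed.

Variables (M H : nat) (w : R).
Hypotheses (M_gt0 : (0 < M)%N) (H_gt0 : (0 < H)%N) (w_gt0 : 0 < w).
Implicit Types f g : 'I_M -> R.

(** The affine map takes [- w, w] to [0, H]; the rounded value is the number of grid heights below
    [v]. *)
Definition level (v : R) : nat := Num.truncn (H%:R * (v + w) / (2 * w)).

Lemma level_le v : v <= w -> (level v <= H)%N.
Proof.
move=> vw; rewrite -[H in (_ <= H)%N](natrK (R := R)); apply: le_truncn.
rewrite ler_pdivrMr ?mulr_gt0 // ler_wpM2l ?ler0n //; lra.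
Qed.

Lemma level_itv v : - w <= v ->
  (level v)%:R <= H%:R * (v + w) / (2 * w) < (level v)%:R + 1.
Proof.
move=> wv; rewrite natr1; apply: truncn_itv.
apply: divr_ge0; apply: mulr_ge0; rewrite ?ler0n ?(ltW w_gt0) //.
by rewrite -lerBlDr sub0r.
Qed.

Definition bit f (z : 'I_M * 'I_H) : bool := (z.2 < level (f z.1 - mean f))%N.

Definition agreement f g : R :=
  #|[pred z | bit f z == bit g z]|%:R / (M * H)%N%:R.

(** In column x the bits differ at |n x - n' x| heights. Rounding two levels down changes their
    difference by at most 1 out of [H], and averaging over the columns preserves this error. *)
Lemma agreement_l1 f g :
  (forall x, `|f x - mean f| <= w) -> (forall x, `|g x - mean g| <= w) ->
  `|1 - l1 (fun x => (f x - g x) - mean (fun x => f x - g x)) / (2 * w) - agreement f g|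
    <= H%:R^-1.
Proof.
move=> fw gw.
have MR := gt0_natr R M_gt0 : 0 < M%:R :> R; have HR := gt0_natr R H_gt0 : 0 < H%:R :> R.
pose n x := level (f x - mean f); pose n' x := level (g x - mean g).
have nH x : (n x <= H)%N by apply: level_le; have := fw x; rewrite ler_norml => /andP[].
have n'H x : (n' x <= H)%N by apply: level_le; have := gw x; rewrite ler_norml => /andP[].
pose D := (\sum_(x < M) ((n x - n' x) + (n' x - n x)))%N.
have disagreeE : agreement f g = 1 - D%:R / (M * H)%N%:R.
  have cardE : (#|[pred z | bit f z == bit g z]| + D = M * H)%N.
    have := cardC [pred z | bit f z == bit g z]; rewrite card_prod !card_ord => <-.
    congr addn; rewrite -sum1_card big_mkcond /D /=.
    rewrite -(pair_bigA _ (fun x y => if (x, y) \in predC [pred z | bit f z == bit g z] then 1 else 0)%N) /=.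
    apply: eq_bigr => x _; rewrite -(sum_ltn_xor (nH x) (n'H x)); apply: eq_bigr => y _.
    by rewrite !inE /bit /=; case: eqP.
  apply/eqP; rewrite eq_sym subr_eq -mulrDl -natrD cardE divff //.
  by rewrite pnatr_eq0 -lt0n muln_gt0 M_gt0.
rewrite disagreeE.
have close x : `| `|(f x - g x) - mean (fun x => f x - g x)| * H%:R / (2 * w) -
    ((n x - n' x) + (n' x - n x))%N%:R| <= 1.
  have -> : f x - g x - mean (fun x => f x - g x) = (f x - mean f) - (g x - mean g).
    by rewrite meanD meanN; ring.
  have natE : ((n x - n' x) + (n' x - n x))%N%:R = `|(n x)%:R - (n' x)%:R| :> R.
    case: (leqP (n x) (n' x)) => [le|/ltnW le].
      by rewrite (eqP le) add0n natrB // distrC ger0_norm // subr_ge0 ler_nat.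
    by rewrite (eqP le) addn0 natrB // ger0_norm // subr_ge0 ler_nat.
  have /level_itv : - w <= f x - mean f by have := fw x; rewrite ler_norml => /andP[].
  have /level_itv : - w <= g x - mean g by have := gw x; rewrite ler_norml => /andP[].
  rewrite -/(n x) -/(n' x) natE => /andP[g1 g2] /andP[f1 f2].
  have -> : `|f x - mean f - (g x - mean g)| * H%:R / (2 * w) =
      `|H%:R * (f x - mean f + w) / (2 * w) - H%:R * (g x - mean g + w) / (2 * w)|.
    rewrite -mulrBl -mulrBr normrM normrM ger0_norm ?ler0n // [X in _ = _ * X]ger0_norm.
      by rewrite [X in X / _]mulrC; congr (_ * `|_| / _); ring.
    by rewrite invr_ge0 mulr_ge0 // ltW.
  apply: le_trans (ler_dist_dist _ _) _; rewrite ler_norml; apply/andP; split; lra.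
have -> : l1 (fun x => f x - g x - mean (fun x => f x - g x)) / (2 * w) =
    (\sum_x `|f x - g x - mean (fun x => f x - g x)| * H%:R / (2 * w)) / (M * H)%N%:R.
  rewrite /l1 /mean -!mulr_suml natrM; field; rewrite !gt_eqF //.
have subE (a b c : R) : 1 - a / c - (1 - b / c) = - ((a - b) / c) by ring.
have MH : 0 < (M * H)%N%:R :> R by rewrite natrM mulr_gt0.
rewrite subE normrN normrM [X in _ * X]ger0_norm ?invr_ge0 ?(ltW MH) //.
rewrite ler_pdivrMr // natrM [_ * H%:R]mulrC mulKf ?gt_eqF // natr_sum -sumrB.
apply: le_trans (ler_norm_sum _ _ _) _.
rewrite -[X in _ <= X%:R]card_ord -sumr_const; apply: ler_sum => x _; exact: close.
Qed.

End Bits.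

(** * Bits of polygons *)

Section PolygonBits.
Context {R : realType}.
Implicit Types P Q : polygon R.

Lemma slide_mean_le M P m i (x : 'I_M) : (0 < M)%N -> (size P <= m)%N ->
  (i < size P)%N -> `|slide P i x - mean (slide P i : 'I_M -> R)| <= span_bound m.
Proof.
move=> M_gt0 Pm iP; rewrite -{1}(mean_cst M_gt0 (slide P i x)) -meanN -meanD.
rewrite /mean normrM [X in _ * X]ger0_norm ?invr_ge0 ?ler0n //.
rewrite -[leRHS](mean_cst M_gt0) ler_pM2r ?invr_gt0 ?(gt0_natr R M_gt0) //.
apply: le_trans (ler_norm_sum _ _ _) _; apply: ler_sum => y _.
exact: slide_span.
Qed.

(** The grid sizes depend only on [m], [r] and [eta], so one finite sample space serves all polygons
    with at most [m] vertices. *)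
Lemma polygon_bits m r r' eta : 0 < eta -> 0 <= r -> r < span_bound m ->
  exists (A : finType) (b : polygon R -> nat -> A -> bool), (0 < #|A|)%N /\
  forall P Q, (size P <= m)%N -> (size Q <= m)%N ->
  (polygon_dist P Q <= r -> exists s s', [/\ (s < m)%N, (s' < m)%N &
     1 - (2 * r - r ^+ 2 / span_bound m) / (2 * span_bound m) - eta <=
       fraction R [pred a | b P s a == b Q s' a]]) /\
  (r' < polygon_dist P Q -> forall s s',
     fraction R [pred a | b P s a == b Q s' a] <=
       1 - r' / (2 * span_bound m) + eta).
Proof.
move=> eta0 r0 rw; set w := span_bound m; have w0 : 0 < w := span_bound_gt0 m.
(* Half of [eta] pays for the rounding of heights, the other half for the horizontal grid. *)
pose H := (Num.truncn (2 / eta)).+1.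
have H_gt0 : (0 < H)%N by [].
have HR : 0 < H%:R :> R by rewrite ltr0n.
have Heta : H%:R^-1 <= eta / 2.
  rewrite -[leRHS]invrK lef_pV2 ?posrE ?invr_gt0 ?divr_gt0 // invf_div ltW //.
  exact: truncnS_gt.
(* The first bound keeps the loss in L1 distance below w eta; the second keeps r + e in the range
   where the mean reduction applies. *)
pose e := Num.min (w * eta / 2) (w - r).
have e0 : 0 < e by rewrite /e lt_min subr_gt0 rw andbT divr_gt0 // mulr_gt0.
have e1 : e <= w * eta / 2 by rewrite /e ge_min lexx.
have e2 : e <= w - r by rewrite /e ge_min lexx orbT.
pose M := (Num.truncn (grid_error m * 2 / e)).+1.
have M_gt0 : (0 < M)%N by [].
have MR : 0 < M%:R :> R by rewrite ltr0n.
have err : grid_error m / M%:R <= e / 2.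
  rewrite ler_pdivrMr // mulrC -ler_pdivrMr ?divr_gt0 // ltW //.
  by rewrite invf_div mulrA truncnS_gt.
have err0 : 0 <= grid_error m / M%:R :> R.
  apply: divr_ge0; last exact: ltW.
  by rewrite /grid_error !mulr_ge0 ?pi_ge0 ?exprn_ge0.
(* A polygon with fewer than [m] vertices repeats its slides, so that every index below [m] is
   meaningful. *)
pose b P s : 'I_M * 'I_H -> bool := bit w (slide P (s %% size P)).
exists ('I_M * 'I_H)%type, b; split; first by rewrite card_prod !card_ord muln_gt0.
move=> P Q Pm Qm.
have sizeP_gt0 (P' : polygon R) : (0 < size P')%N by apply: leq_trans (polygon_size P').
have agrE s s' : fraction R [pred a | b P s a == b Q s' a] =
    agreement H w (slide P (s %% size P) : 'I_M -> R) (slide Q (s' %% size Q)).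
  by rewrite /fraction /agreement card_prod !card_ord.
have agr s s' := agreement_l1 M_gt0 H_gt0 w0
  (fun x : 'I_M => slide_mean_le x M_gt0 Pm (ltn_pmod s (sizeP_gt0 P)))
  (fun x : 'I_M => slide_mean_le x M_gt0 Qm (ltn_pmod s' (sizeP_gt0 Q))).
split=> [near|far s s'].
- have near' : polygon_dist P Q < r + e / 2 by apply: le_lt_trans near _; lra.
  have [i [j [a le1]]] := exists_slides_near M_gt0 Pm Qm near'.
  exists i, j; split; [exact: leq_trans Pm|exact: leq_trans Qm|].
  have := agr i j; rewrite agrE !modn_small //.
  set f := slide P i; set g := slide Q j.
  have span x y : (f x - g x) - (f y - g y) <= 2 * w.
    have := slide_span M_gt0 x y Pm (ltn_ord i).
    have := slide_span M_gt0 y x Qm (ltn_ord j).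
    rewrite -/f -/g -/w => /ler_normlW ? /ler_normlW ?; lra.
  have le2 : l1 (fun x => f x - g x + a) <= r + e by apply: le_trans le1 _; lra.
  have re : r + e <= w by lra.
  have le3 := l1_sub_mean_le M_gt0 w0 span le2 re.
  have d0 : 0 <= r + e.
    by apply: le_trans le2; rewrite /l1 -(mean_cst M_gt0 0); apply: le_mean.
  (* On nonnegative numbers s -> 2 s - s^2 / w has slope at most 2, and 2 e <= w eta. *)
  have le4 : 2 * (r + e) - (r + e) ^+ 2 / w <= 2 * r - r ^+ 2 / w + w * eta.
    have : r ^+ 2 / w <= (r + e) ^+ 2 / w.
      by rewrite ler_pM2r ?invr_gt0 // ler_sqr ?nnegrE //; lra.
    lra.
  rewrite ler_norml => /andP[_]; rewrite -/w.
  set X := l1 _ in le3 *.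
  have le5 : X / (2 * w) <= (2 * r - r ^+ 2 / w) / (2 * w) + eta / 2.
    rewrite (_ : eta / 2 = (w * eta) / (2 * w)); last by field; lra.
    by rewrite -mulrDl ler_pM2r ?invr_gt0 ?mulr_gt0 //; lra.
  lra.
have := agr s s'; rewrite agrE ler_norml => /andP[+ _]; rewrite -/w.
have is_ := ltn_pmod s (sizeP_gt0 P); have js := ltn_pmod s' (sizeP_gt0 Q).
set f := slide P _; set g := slide Q _.
(* Subtracting the mean of the difference is one of the admissible vertical translations. *)
have := polygon_dist_le_slides M_gt0 (- mean (fun x => f x - g x)) Pm Qm is_ js.
rewrite -/f -/g; set X := l1 _ => far'.
have le5 : r' / (2 * w) <= X / (2 * w) + eta / 2.
  rewrite (_ : eta / 2 = (w * eta) / (2 * w)); last by field; lra.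
  by rewrite -mulrDl ler_pM2r ?invr_gt0 ?mulr_gt0 //; lra.
lra.
Qed.
End PolygonBits.

(** * The programs *)

Section Programs.
Local Open Scope nat_scope.

(* Variables: 0 holds the answer, 1 the number n of objects, 2 the number J of
   keys per object, 3 the bound A on the keys, 4 the fuel of the query, 5 a
   counter, 6 a key, 7 a pointer, 8 a candidate and 9 its nearness.
   Entry t = i J + j stands for key j of object i, and a pointer is 0 or the
   successor of an entry; cell b < A points to the first entry of bucket b, and
   cell A + t to the entry that follows t. *)
Definition prep_step : cmd :=
  Seq (Hash 6 (Defs.Sub (Var 5) (Mul (Div (Var 5) (Var 2)) (Var 2)))
              (Div (Var 5) (Var 2)))
  (Seq (Read 7 (Var 6))
  (Seq (Write (Add (Var 3) (Var 5)) (Var 7))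
  (Seq (Assign 5 (Add (Var 5) (Cst 1)))
       (Write (Var 6) (Var 5))))).

Definition prep_prog : cmd :=
  While (Leq (Add (Var 5) (Cst 1)) (Mul (Var 1) (Var 2))) prep_step.

Definition query_step : cmd :=
  Seq (Assign 4 (Defs.Sub (Var 4) (Cst 1)))
  (If (Var 7)
    (Seq (Assign 8 (Div (Defs.Sub (Var 7) (Cst 1)) (Var 2)))
    (Seq (Near 9 (Var 8) (Var 1))
      (If (Var 9)
        (Seq (Assign 0 (Var 8)) (Assign 4 (Cst 0)))
        (Read 7 (Defs.Sub (Add (Var 3) (Var 7)) (Cst 1))))))
    (If (Leq (Add (Var 5) (Cst 1)) (Var 2))
      (Seq (Hash 6 (Var 5) (Var 1))
      (Seq (Read 7 (Var 6))
           (Assign 5 (Add (Var 5) (Cst 1)))))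
      Skip)).

Definition query_prog : cmd := While (Var 4) query_step.

(** * Correctness and running time of the programs *)

Section Correctness.
Variables (T : Type) (n J A : nat) (data : n.-tuple T) (hash : nat -> T -> nat).
Variables (near : rel T) (word : nat).
Hypothesis J_gt0 : 0 < J.
Hypothesis hash_lt : forall j x, j < J -> hash j x < A.
Hypothesis A_lt_word : A < word.
Hypothesis J_lt_word : J < word.
Hypothesis nJ_lt_word : n * J < word.
Let space := A + n * J.

Definition entry_obj (t : nat) (t_lt : t < n * J) : 'I_n :=
  Ordinal (etrans (ltn_divLR t n J_gt0) t_lt).

Definition entry_key (t : nat) : nat :=
  if onth data (t %/ J) is Some o then hash (t %% J) o else 0.

(** The array after [t] insertions. Each entry is prepended to its bucket: its link cell receives
    the old head, and the head becomes the successor of the entry. *)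
Fixpoint table (t : nat) : nat -> nat :=
  if t is t'.+1 then
    update (update (table t') (A + t') (table t' (entry_key t')))
           (entry_key t') t'.+1
  else fun=> 0.

Lemma onth_tuple (i : 'I_n) : onth data i = Some (tnth data i).
Proof.
by rewrite (tnth_nth (tnth data i)) onthE (nth_map (tnth data i)) ?size_tuple.
Qed.

Lemma entry_keyE t (h : t < n * J) :
  entry_key t = hash (t %% J) (tnth data (entry_obj h)).
Proof. by rewrite /entry_key (onth_tuple (entry_obj h)). Qed.

Lemma entry_key_lt t : t < n * J -> entry_key t < A.
Proof. by move=> h; rewrite (entry_keyE h) hash_lt // ltn_pmod. Qed.

Lemma table_le t b : t <= n * J -> table t b <= t.
Proof.
elim: t b => [|t IH] b ht //=; rewrite /update.
case: eqP => // _; case: eqP => _; exact: leqW (IH _ (ltnW ht)).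
Qed.

Lemma exec_prep_step v t : t < n * J ->
  v 1 = n -> v 2 = J -> v 3 = A -> v 5 = t ->
  exists v', [/\ exec data hash near word space prep_step v (table t) 5 v'
    (table t.+1), v' 1 = n, v' 2 = J, v' 3 = A & v' 5 = t.+1].
Proof.
move=> ht v1 v2 v3 v5.
have kA := entry_key_lt ht.
pose k := entry_key t; pose p := table t k.
pose v6 := update v 6 k; pose v7 := update v6 7 p; pose v5' := update v7 5 t.+1.
exists v5'; split=> //.
have t1w : t.+1 < word by apply: leq_ltn_trans nJ_lt_word.
apply: (@ExecSeq _ _ _ _ _ _ _ _ _ _ 1 v6 (table t) 4).
  have := @ExecHash _ data hash near word space 6
    (Defs.Sub (Var 5) (Mul (Div (Var 5) (Var 2)) (Var 2))) (Div (Var 5) (Var 2))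
    v (table t) (tnth data (entry_obj ht)).
  rewrite /= v5 v2 (_ : t - t %/ J * J = t %% J); last by rewrite {1}(divn_eq t J) addKn.
  rewrite -(entry_keyE ht).
  apply; first exact: (onth_tuple (entry_obj ht)).
  exact: ltn_trans A_lt_word.
apply: (@ExecSeq _ _ _ _ _ _ _ _ _ _ 1 v7 (table t) 3).
  have := @ExecRead _ data hash near word space 7 (Var 6) v6 (table t).
  by apply; rewrite /= /v6 /update /= ltn_addr.
apply: (@ExecSeq _ _ _ _ _ _ _ _ _ _ 1 v7 (update (table t) (A + t) p) 2).
  have := @ExecWrite _ data hash near word space (Add (Var 3) (Var 5)) (Var 7) v7 (table t).
  rewrite /= (_ : v7 3 = A) // (_ : v7 5 = t) // (_ : v7 7 = p) //; apply.
    by rewrite ltn_add2l.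
  by apply: leq_ltn_trans nJ_lt_word; apply: leq_trans (table_le _ _) _; apply: ltnW.
apply: (@ExecSeq _ _ _ _ _ _ _ _ _ _ 1 v5' (update (table t) (A + t) p) 1).
  have := @ExecAssign _ data hash near word space 5 (Add (Var 5) (Cst 1)) v7
    (update (table t) (A + t) p).
  by rewrite /= (_ : v7 5 = t) // addn1; apply.
have := @ExecWrite _ data hash near word space (Var 6) (Var 5) v5'
  (update (table t) (A + t) p).
apply => //.
by rewrite /= (_ : v5' 6 = k) // ltn_addr.
Qed.

(** An iteration costs five commands and one loop test; the final failing test adds 1. *)
Lemma exec_prep_from v d t : t + d = n * J ->
  v 1 = n -> v 2 = J -> v 3 = A -> v 5 = t ->
  exists v', exec data hash near word space prep_prog v (table t)
               (6 * d).+1 v' (table (n * J)).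
Proof.
elim: d v t => [|d IH] v t td v1 v2 v3 v5.
  exists v; rewrite -td addn0.
  apply: ExecWhileFalse; rewrite /= v5 v1 v2 -td; lia.
have ht : t < n * J by lia.
have [v' [ev v'1 v'2 v'3 v'5]] := exec_prep_step ht v1 v2 v3 v5.
have [|v'' ev'] := IH v' t.+1 _ v'1 v'2 v'3 v'5; first lia.
exists v''.
rewrite (_ : (6 * d.+1).+1 = (5 + (6 * d).+1).+1); last lia.
apply: ExecWhileTrue ev ev'.
by rewrite /= v5 v1 v2 addn1 ht.
Qed.

Lemma exec_prep v : v 1 = n -> v 2 = J -> v 3 = A -> v 5 = 0 ->
  exists v', exec data hash near word space prep_prog v (fun=> 0)
               (6 * (n * J)).+1 v' (table (n * J)).
Proof. by move=> *; apply: (@exec_prep_from v (n * J) 0). Qed.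

Fixpoint chain (a : nat -> nat) (p : nat) (l : seq nat) : Prop :=
  if l is t :: l' then p = t.+1 /\ chain a (a (A + t)) l' else p = 0.

(** The order is decreasing because insertion takes place at the head. *)
Definition bucket (t b : nat) : seq nat := [seq x <- rev (iota 0 t) | entry_key x == b].

Lemma bucketS t b : bucket t.+1 b =
  if entry_key t == b then t :: bucket t b else bucket t b.
Proof. by rewrite /bucket -addn1 iotaD rev_cat /= add0n. Qed.

Lemma chain_eq a a' p l : (forall t, t \in l -> a (A + t) = a' (A + t)) ->
  chain a p l -> chain a' p l.
Proof.
elim: l p => [|t l IH] p //= aa' [pt ch]; split=> //.
rewrite -aa' ?mem_head //; apply: IH => // x xl; apply: aa'.
by rewrite inE xl orbT.
Qed.

Lemma mem_bucket t b x : x \in bucket t b -> x < t /\ entry_key x = b.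
Proof.
by rewrite mem_filter mem_rev mem_iota add0n => /andP[/eqP ? /andP[]].
Qed.

Lemma chain_table t b : t <= n * J -> b < A -> chain (table t) (table t b) (bucket t b).
Proof.
elim: t b => [|t IH] b ht bA //.
have kA := entry_key_lt ht.
(* Inserting entry [t] writes a head cell, below [A], and cell A + t; the links of earlier entries
   are neither. *)
have keep c x : x \in bucket t c -> table t (A + x) = table t.+1 (A + x).
  move=> /mem_bucket[xt _] /=; rewrite /update.
  by case: eqP => [|_]; [lia|case: eqP => //; lia].
have next : table t.+1 (A + t) = table t (entry_key t).
  rewrite /= /update eqxx ifN_eq //; lia.
rewrite bucketS; case: (eqVneq (entry_key t) b) => [kb|ne].
  split; first by rewrite -kb /= /update eqxx.
  by rewrite next -kb; apply: chain_eq (IH _ (ltnW ht) kA) => x; apply: keep.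
rewrite (_ : table t.+1 b = table t b); last first.
  by rewrite /= /update eq_sym (negbTE ne) ifN_eq //; lia.
by apply: chain_eq (IH _ (ltnW ht) bA) => x; apply: keep.
Qed.

Section Query.
Variable q : T.
Let objs := rcons data q.

Definition near_entry (t : nat) : bool :=
  if onth data (t %/ J) is Some o then near o q else false.

Lemma near_entryE t (h : t < n * J) :
  near_entry t = near (tnth data (entry_obj h)) q.
Proof. by rewrite /near_entry (onth_tuple (entry_obj h)). Qed.

Definition probes (j : nat) : seq nat :=
  flatten [seq bucket (n * J) (hash i q) | i <- iota j (J - j)].

Lemma onth_objs_n : onth objs n = Some q.
Proof. by rewrite onthE (nth_map q) ?size_rcons ?size_tuple // nth_rcons size_tuple ltnn eqxx. Qed.

Lemma onth_objs (i : 'I_n) : onth objs i = Some (tnth data i).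
Proof.
rewrite onthE (nth_map q) ?size_rcons ?size_tuple ?(leqW (ltn_ord i)) //.
by rewrite nth_rcons size_tuple ltn_ord (tnth_nth q).
Qed.

(** Invariant of the query loop: [l] is the unread part of the current bucket and [probes (v 5)] the
    content of the unopened ones. A unit of fuel pays for inspecting an entry or opening a bucket,
    at most 10 steps, so fuel above the number of far entries and unopened buckets suffices to reach
    a near entry. *)
Lemma exec_query_from f v l : f < word ->
  v 1 = n -> v 2 = J -> v 3 = A -> v 4 = f -> v 5 <= J ->
  chain (table (n * J)) (v 7) l -> all (fun t => t < n * J) l ->
  exists t' v', [/\ exec objs hash near word space query_prog v (table (n * J))
                      t' v' (table (n * J)),
    t' <= 10 * f + 1 &
    has near_entry (l ++ probes (v 5)) ->
    count (predC near_entry) (l ++ probes (v 5)) + (J - v 5) < f ->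
    exists t (h : t < n * J), near_entry t /\ v' 0 = entry_obj h].
Proof.
elim: f v l => [|f IH] v l fw v1 v2 v3 v4 v5 ch al.
  exists 1, v; split=> //; by apply: ExecWhileFalse; rewrite /= v4.
have f1w : f < word by apply: ltnW.
pose v0 := update v 4 f.
have step0 : exec objs hash near word space (Assign 4 (Defs.Sub (Var 4) (Cst 1))) v
    (table (n * J)) 1 v0 (table (n * J)).
  have := @ExecAssign _ objs hash near word space 4 (Defs.Sub (Var 4) (Cst 1)) v
    (table (n * J)).
  by rewrite /= v4 subn1; apply.
have v4n0 : Defs.eval v (Var 4) != 0 by rewrite /= v4.
case: l ch al => [|t l] /=.
  move=> v7 _.
  have [v5J|v5J] := ltnP (v 5) J; last first.
    (* All buckets are exhausted: the loop idles until the fuel is used up, and no near entry is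
       left to be found. *)
    have [t' [v' [ev t'le res]]] := IH v0 [::] f1w v1 v2 v3 erefl v5 v7 isT.
    exists (1 + 3 + t').+1, v'; split; last 2 first.
    - lia.
    - by rewrite /probes (_ : J - v 5 = 0) //; apply/eqP; rewrite subn_eq0.
    apply: ExecWhileTrue ev => //; apply: ExecSeq step0 _.
    apply: (@ExecIfFalse _ _ _ _ _ _ _ _ _ _ _ 2) => //.
    apply: (@ExecIfFalse _ _ _ _ _ _ _ _ _ _ _ 1); last exact: ExecSkip.
    rewrite /= /v0 /update /= v2; lia.
  pose h := hash (v 5) q; pose p := table (n * J) h.
  have hA : h < A by apply: hash_lt.
  pose v3' := update (update (update v0 6 h) 7 p) 5 (v 5).+1.
  have [||] := IH v3' (bucket (n * J) h) f1w v1 v2 v3 erefl v5J.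
  - exact: chain_table.
  - by apply/allP => x /mem_bucket[].
  move=> t' [v' [ev t'le res]].
  have split_probes : probes (v 5) = bucket (n * J) h ++ probes (v 5).+1.
    by rewrite /probes -{1}(subnSK v5J).
  exists (1 + (1 + (1 + 1)).+2 + t').+1, v'; split; last 2 first.
  - lia.
  - rewrite split_probes => near_ far_; apply: res => //.
    by rewrite (_ : v3' 5 = (v 5).+1) //; lia.
  apply: ExecWhileTrue ev => //; apply: ExecSeq step0 _.
  apply: ExecIfFalse => //.
  apply: ExecIfTrue; first by rewrite /= /v0 /update /= v2; lia.
  apply: (@ExecSeq _ _ _ _ _ _ _ _ _ _ _ (update v0 6 h) (table (n * J))).
    have := @ExecHash _ objs hash near word space 6 (Var 5) (Var 1) v0 (table (n * J)) q.
    apply; first by rewrite /= /v0 /update /= v1 onth_objs_n.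
    by apply: ltn_trans A_lt_word.
  apply: (@ExecSeq _ _ _ _ _ _ _ _ _ _ _ (update (update v0 6 h) 7 p) (table (n * J))).
    have := @ExecRead _ objs hash near word space 7 (Var 6) (update v0 6 h) (table (n * J)).
    by apply; rewrite /= {1}/update /= ltn_addr.
  rewrite /v3'.
  have := @ExecAssign _ objs hash near word space 5 (Add (Var 5) (Cst 1))
    (update (update v0 6 h) 7 p) (table (n * J)).
  rewrite /= (_ : update (update v0 6 h) 7 p 5 = v 5) // addn1; apply.
  exact: leq_ltn_trans J_lt_word.
move=> [v7 ch] /andP[tn al].
pose i := entry_obj tn.
pose v8 := update v0 8 i.
pose v9 := update v8 9 (near (tnth data i) q).
have step8 : exec objs hash near word space
    (Assign 8 (Div (Defs.Sub (Var 7) (Cst 1)) (Var 2))) v0 (table (n * J)) 1 v8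
    (table (n * J)).
  have := @ExecAssign _ objs hash near word space 8
    (Div (Defs.Sub (Var 7) (Cst 1)) (Var 2)) v0 (table (n * J)).
  rewrite /= (_ : v0 7 = t.+1) // (_ : v0 2 = J) // subn1 /=; apply.
  exact: leq_ltn_trans (leq_div _ _) (ltn_trans tn nJ_lt_word).
have step9 : exec objs hash near word space (Near 9 (Var 8) (Var 1)) v8
    (table (n * J)) 1 v9 (table (n * J)).
  apply: (@ExecNear _ _ _ _ _ _ _ _ _ _ _ (tnth data i) q) => /=.
    by rewrite {1}/v8 {1}/update /= (onth_objs i).
  by rewrite /v8 /v0 /update /= v1 onth_objs_n.
have [nr|fr] := boolP (near (tnth data i) q).
  (* The candidate is near: it is stored as the answer, and setting the fuel to 0 ends the loop. *)
  exists (1 + (1 + (1 + (1 + 1).+1)).+1 + 1).+1, (update (update v9 0 i) 4 0).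
  split; [|lia|].
    apply: (@ExecWhileTrue _ _ _ _ _ _ _ _ _ _ _ (update (update v9 0 i) 4 0) (table (n * J)) 1) => //; last first.
      by apply: ExecWhileFalse; rewrite /= /update.
    apply: ExecSeq step0 _; apply: ExecIfTrue.
      by rewrite /= /v0 /update /= v7.
    apply: ExecSeq step8 _; apply: ExecSeq step9 _.
    apply: ExecIfTrue; first by rewrite /= /v9 /update /= nr.
    apply: (@ExecSeq _ _ _ _ _ _ _ _ _ _ _ (update v9 0 i) (table (n * J))).
      have := @ExecAssign _ objs hash near word space 0 (Var 8) v9 (table (n * J)).
      rewrite /= (_ : v9 8 = i) //; apply.
      exact: leq_ltn_trans (leq_div _ _) (ltn_trans tn nJ_lt_word).
    have := @ExecAssign _ objs hash near word space 4 (Cst 0) (update v9 0 i) (table (n * J)).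
    by apply; apply: leq_ltn_trans A_lt_word.
  by move=> _ _; exists t, tn; rewrite near_entryE.
pose v7' := update v9 7 (table (n * J) (A + t)).
have [||] := IH v7' l f1w v1 v2 v3 erefl v5.
- by rewrite {1}/v7' {1}/update.
- by [].
move=> t' [v' [ev t'le res]].
exists (1 + (1 + (1 + 1.+1)).+1 + t').+1, v'; split; [|lia|].
  apply: ExecWhileTrue ev => //; apply: ExecSeq step0 _; apply: ExecIfTrue.
    by rewrite /= /v0 /update /= v7.
  apply: ExecSeq step8 _; apply: ExecSeq step9 _.
  apply: ExecIfFalse; first by rewrite /= /v9 /update /= (negbTE fr).
  have := @ExecRead _ objs hash near word space 7 (Defs.Sub (Add (Var 3) (Var 7)) (Cst 1)) v9 (table (n * J)).
  rewrite /= (_ : v9 3 = A) // (_ : v9 7 = t.+1) // addnS subn1 /=.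
  by apply; rewrite ltn_add2l.
rewrite /= near_entryE (negbTE fr) /= => hn hc; apply: res => //.
Qed.

Lemma exec_query f v : f < word ->
  v 1 = n -> v 2 = J -> v 3 = A -> v 4 = f -> v 5 = 0 -> v 7 = 0 ->
  exists t' v', [/\ exec objs hash near word space query_prog v (table (n * J))
                      t' v' (table (n * J)),
    t' <= 10 * f + 1 &
    has near_entry (probes 0) -> count (predC near_entry) (probes 0) + J < f ->
    exists i : 'I_n, near (tnth data i) q /\ v' 0 = i].
Proof.
move=> fw v1 v2 v3 v4 v5 v7.
have [|||t' [v' [ev le res]]] := @exec_query_from f v [::] fw v1 v2 v3 v4; rewrite ?v5 //.
exists t', v'; split=> // h1 h2.
have [||t [ht [nt e]]] := res; rewrite ?v5 ?subn0 //.
by exists (entry_obj ht); rewrite -near_entryE.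
Qed.

End Query.
End Correctness.
End Programs.

(** * The uniform law on an initial segment of the naturals *)

Section UniformNat.
Variables (R : realType) (N : nat).

(** A finite sample space is transported to [nat], where every set is measurable, so no event needs
    a measurability argument. *)
Definition uniform_nat : set nat -> \bar R :=
  mscale ((N.+1%:R : R)^-1)%:nng
    (msum (fun i => \d_i) N.+1).

HB.instance Definition _ := Measure.on uniform_nat.

Lemma uniform_natE (E : set nat) :
  uniform_nat E = (N.+1%:R^-1 * (\sum_(i < N.+1) (nat_of_ord i \in E)%:R))%:E.
Proof.
rewrite /uniform_nat /mscale /= /msum EFinM -sumEFin; congr (_ * _)%E.
Qed.

Lemma uniform_nat_setT : uniform_nat setT = 1%E.
Proof.
rewrite uniform_natE (eq_bigr (fun=> 1)); last by move=> i _; rewrite in_setT.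
by rewrite sumr_const card_ord mulVf ?pnatr_eq0.
Qed.

HB.instance Definition _ := Measure_isProbability.Build _ _ _ uniform_nat uniform_nat_setT.

End UniformNat.

(** * From finite hash families to LSH structures *)

Section Reduction.
Context {R : realType}.

Lemma sum_ord_mul (n J : nat) (G : nat -> nat) :
  (\sum_(t < n * J) G t = \sum_(i < n) \sum_(j < J) G (i * J + j))%N.
Proof.
elim: n => [|n IH]; first by rewrite !big_ord0.
by rewrite big_ord_recr -IH mulSnr big_split_ord.
Qed.

(** Writing entries as i J + j turns the far entries met by a query into the triple sum of
    collisions that [lsh_success] bounds. *)
Lemma count_probes (T : Type) (n J : nat) (data : n.-tuple T) (hash : nat -> T -> nat)
    (near : rel T) (q : T) : (0 < J)%N ->
  count (predC (near_entry J data near q)) (probes J data hash q 0) =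
  (\sum_(j' < J) \sum_(i < n) \sum_(j < J)
     (~~ near (tnth data i) q && (hash j (tnth data i) == hash j' q)))%N.
Proof.
move=> J0; rewrite /probes subn0 count_flatten -map_comp sumnE big_map.
rewrite -[J in iota 0 J]subn0 -/(index_iota 0 J) big_mkord; apply: eq_bigr => j' _ /=.
rewrite /bucket count_filter.
have iotaE : iota 0 (n * J) = index_iota 0 (n * J) by rewrite /index_iota subn0.
rewrite count_rev -sum1_count iotaE big_mkord big_mkcond (sum_ord_mul n J (fun t => if (predI (predC (near_entry J data near q))
  (fun x => entry_key J data hash x == hash j' q)) t then 1 else 0)%N).
apply: eq_bigr => i _; apply: eq_bigr => j _.
have tn : (i * J + j < n * J)%N.
  apply: (@leq_trans (i * J + J)); first by rewrite ltn_add2l.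
  by rewrite -mulSnr leq_mul2r ltn_ord orbT.
have iE : entry_obj J0 tn = i.
  by apply: val_inj; rewrite /= divnMDl // divn_small ?addn0.
rewrite /= (near_entryE data near J0 q tn) (entry_keyE data hash J0 tn) iE modnMDl modn_small //.
Qed.

Lemma near_probes (T : Type) (n J : nat) (data : n.-tuple T) (hash : nat -> T -> nat)
    (near : rel T) (q : T) (i : 'I_n) (j j' : 'I_J) :
  near (tnth data i) q -> hash j (tnth data i) = hash j' q ->
  has (near_entry J data near q) (probes J data hash q 0).
Proof.
move=> nr e; have J0 : (0 < J)%N := leq_ltn_trans (leq0n j) (ltn_ord j).
have tn : (i * J + j < n * J)%N.
  apply: (@leq_trans (i * J + J)); first by rewrite ltn_add2l.
  by rewrite -mulSnr leq_mul2r ltn_ord orbT.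
have iE : entry_obj J0 tn = i.
  by apply: val_inj; rewrite /= divnMDl // divn_small ?addn0.
apply/hasP; exists (i * J + j)%N; last by rewrite (near_entryE data near J0 q tn) iE.
apply/flatten_mapP; exists (nat_of_ord j'); first by rewrite mem_iota subn0 add0n /=.
rewrite mem_filter mem_rev mem_iota add0n /= tn (entry_keyE data hash J0 tn) iE.
by rewrite modnMDl modn_small // e eqxx.
Qed.

(** Correctness of the programs reduces an LSH structure to counting: one collision with an
    acceptable object, and fewer than [F] far collisions and query keys together. *)
Lemma LSH_of_finite (T : Type) (d : T -> T -> R) (n : nat) (r r' p : R)
    (J A F word space : nat) (pt qt : R)
    (Om : finType) (hash : Om -> nat -> T -> nat) :
  (0 < #|Om|)%N -> (0 < J)%N -> (forall omega j x, j < J -> hash omega j x < A)%N ->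
  (A < word)%N -> (J < word)%N -> (n < word)%N -> (n * J < word)%N -> (F < word)%N ->
  (6 * (n * J)).+1%:R <= pt -> (10 * F + 1)%N%:R <= qt ->
  (forall (data : n.-tuple T) q, (exists i, d (tnth data i) q <= r) ->
    exists good : pred Om, p <= fraction R good /\
    forall omega, good omega ->
      (exists i (j j' : 'I_J), d (tnth data i) q <= r' /\
          hash omega j (tnth data i) = hash omega j' q) /\
      ((\sum_(j' < J) \sum_(i < n) \sum_(j < J)
         ((r' < d (tnth data i) q)%R && (hash omega j (tnth data i) == hash omega j' q)))
        + J < F)%N) ->
  LSH_structure d n r r' p prep_prog query_prog word [:: 0; n; J; A; F]%N
    (A + n * J) pt qt.
Proof.
move=> Om0 J0 hA Aw Jw nw nJw Fw ptP qtP succ; split.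
  by rewrite /= nw Jw Aw Fw (leq_ltn_trans (leq0n _) Aw).
have /card_gt0P[om0 _] := Om0.
(* Numbers beyond the enumeration decode to [om0], so the time bounds hold for them as well; the
   success event excludes them. *)
pose N := #|Om|.-1; pose dec (k : nat) : Om := nth om0 (enum Om) k.
exists _, nat, (uniform_nat R N), (fun k => hash (dec k)); split=> // data near built answered.
have nearE x y : near x y = (d x y <= r') by [].
pose tab k := table J A data (hash (dec k)) (n * J).
have built_tab k : exists v, built k (6 * (n * J)).+1 v (tab k).
  exact: (@exec_prep T n J A data (hash (dec k)) near word J0 (hA (dec k)) Aw Jw nJw).
have answered_tab k q : exists t' v', [/\ answered k q (tab k) t' v' (tab k),
    (t' <= 10 * F + 1)%N &
    has (near_entry J data near q) (probes J data (hash (dec k)) q 0) ->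
    (count (predC (near_entry J data near q)) (probes J data (hash (dec k)) q 0) + J < F)%N ->
    exists i : 'I_n, near (tnth data i) q /\ v' 0%N = i].
  exact: (@exec_query T n J A data (hash (dec k)) near word J0 (hA (dec k)) Aw Jw nJw q).
split=> [k|q nq].
  have [v bv] := built_tab k; exists (6 * (n * J)).+1, v, (tab k); split=> // q.
  have [t' [v' [ans le _]]] := answered_tab k q; exists t', v'; split=> //.
  by apply: le_trans qtP; rewrite ler_nat.
have [good [pgood hgood]] := succ data q nq.
exists [set k | (k < N.+1)%N /\ good (dec k)]; split=> //.
  rewrite [X in (_ <= X)%E]uniform_natE lee_fin; apply: le_trans pgood _.
  have NE : #|Om| = N.+1 by rewrite prednK.
  rewrite /fraction NE mulrC ler_pM2l ?invr_gt0 ?ltr0n //.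
  have -> : #|good|%:R = \sum_(k < N.+1) (good (dec k))%:R :> R.
    rewrite -sum1_card natr_sum big_mkcond /= -big_enum /= (big_nth om0) -cardE NE big_mkord.
    by apply: eq_bigr => k _; rewrite unfold_in; case: (good _).
  by apply: ler_sum => k _; case: (boolP (good _)) => gk; rewrite ?ler0n // mem_set.
move=> k [kN gk]; have [[i [j [j' [dr e]]]] far] := hgood _ gk.
have [v bv] := built_tab k.
have [t' [v' [ans _ res]]] := answered_tab k q.
exists (6 * (n * J)).+1, v, (tab k), t', v', (tab k).
have [||i' [nr v'0]] := res.
- exact: (@near_probes _ _ _ _ _ _ _ i j j').
- rewrite count_probes //; apply: leq_ltn_trans far; rewrite leq_add2r.
  apply: leq_sum => j1 _; apply: leq_sum => i1 _; apply: leq_sum => j2 _.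
  by rewrite /near -ltNge.
by exists i'.
Qed.

End Reduction.

(** * Choice of the parameters *)

Section TableTuning.
Context {R : realType}.

(** It controls how an error [eta] in the probability of one bit propagates to [k] bits. *)
Lemma expr_lipschitz (x y : R) k : 0 <= y -> y <= x -> x <= 1 ->
  x ^+ k - y ^+ k <= k%:R * (x - y).
Proof.
move=> y0 yx x1; elim: k => [|k IH]; first by rewrite !expr0 mul0r; lra.
rewrite !exprS -natr1.
have xk : x ^+ k <= 1 by apply: exprn_ile1; lra.
have yk : 0 <= y ^+ k by apply: exprn_ge0.
have xyk : y ^+ k <= x ^+ k by rewrite lerXn2r ?nnegrE //; lra.
have -> : x * x ^+ k - y * y ^+ k = (x - y) * x ^+ k + y * (x ^+ k - y ^+ k) by ring.
rewrite [leRHS]mulrDl mul1r [leLHS]addrC; apply: lerD.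
  apply: le_trans IH; rewrite ler_piMl //; lra.
by rewrite ler_piMr //; lra.
Qed.

(** It follows from ln (1 + t) <= t at t = 1 / N - 1, and later lets the logarithm absorb additive
    constants. *)
Lemma ln_ge_half (N : nat) : (3 <= N)%N -> 2^-1 <= ln (N%:R : R).
Proof.
move=> N3; have N0 : 0 < N%:R :> R by rewrite ltr0n; apply: leq_trans N3.
have i3 : (N%:R)^-1 <= 3^-1 :> R by rewrite lef_pV2 ?posrE // ler_nat.
have : ln (1 + ((N%:R)^-1 - 1)) <= (N%:R)^-1 - 1 :> R.
  by apply: le_ln1Dx; rewrite ltrBrDl subrr invr_gt0.
rewrite addrC subrK lnV ?posrE //; lra.
Qed.

Lemma scaled_radius_denominatorE m : lambda m + 4 * pi = 2 * span_bound m :> R.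
Proof. by rewrite /span_bound; field. Qed.

Variables (m : nat) (r c : R).
Hypotheses (r0 : 0 < r) (c1 : 1 <= c).
Let x := scaled_radius m r.
Let w : R := span_bound m.
Let rh := rho m r c.

Lemma scaled_radius_gt0 : 0 < x.
Proof.
by rewrite /x /scaled_radius scaled_radius_denominatorE divr_gt0 // mulr_gt0 // span_bound_gt0.
Qed.

Lemma rho_ge0 : 0 <= rh.
Proof.
have x0 := scaled_radius_gt0.
(* In the first case the denominator is the logarithm of a nonpositive number, so it is 0, and so is
   the quotient. *)
rewrite /rh /rho -/x; have [cx1|cx1] := leP 1 (c * x).
  by rewrite [X in _ / X]ln0 ?invr0 ?mulr0 // subr_le0.
have xcx : x <= c * x by rewrite ler_peMl // ltW.
have p1 : 1 - (2 - 2 * x) * x <= 1.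
  by rewrite lerBlDr lerDl mulr_ge0 //; lra.
have p2 : 1 - c * x <= 1 by lra.
by rewrite -mulrNN -invrN divr_ge0 // oppr_ge0 ln_le0.
Qed.

Hypothesis crw : c * r < w.
Hypothesis c2 : 2 - r / w < c.

(** In terms of [x], the hypothesis on [c] reads 2 - 2 x < c, which separates the two probabilities,
    and c r < w reads c x < 1/2. *)
Lemma rho_bounds : let p1 := 1 - (2 - 2 * x) * x in let p2 := 1 - c * x in
  [/\ 2^-1 <= p1, p1 < 1, 2^-1 < p2, p2 < p1 & rh <= 1].
Proof.
have x0 := scaled_radius_gt0; cbv zeta.
have w0 : 0 < w := span_bound_gt0 m.
have rx : r = x * (2 * w).
  by rewrite /x /scaled_radius scaled_radius_denominatorE divfK // gt_eqF // mulr_gt0.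
have cx : c * x < 2^-1.
  by rewrite -(ltr_pM2r w0); move: crw; rewrite {1}rx; lra.
have xcx : x <= c * x by rewrite ler_peMl // ltW.
have c2x : 2 - 2 * x < c.
  have rw : r / w = 2 * x by rewrite {1}rx mulrA mulfK ?gt_eqF // mulrC.
  by move: c2; rewrite rw; lra.
have xx : (2 - 2 * x) * x < c * x by rewrite ltr_pM2r.
(* The left-hand probability is 1/2 + 2 (x - 1/2)^2. *)
have p1h : 2^-1 <= 1 - (2 - 2 * x) * x.
  by have := sqr_ge0 (x - 2^-1); rewrite expr2; lra.
have xx0 : 0 < (2 - 2 * x) * x by rewrite mulr_gt0 //; lra.
split; [by []|lra|lra|lra|].
rewrite /rh /rho -/x -mulrNN -invrN ler_pdivrMr; last first.
  by rewrite oppr_gt0 ln_lt0 //; apply/andP; split; lra.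
rewrite mul1r lerN2 ler_ln ?posrE; lra.
Qed.

(** The usual choice of about ln N / - ln p2 bits and N^rho tables, with an [eta] small enough for
    [k] bits to lose only constant factors. *)
Lemma lsh_parameters (N : nat) : (3 <= N)%N ->
  let p1 := 1 - (2 - 2 * x) * x in let p2 := 1 - c * x in
  exists (k L : nat) (eta : R), [/\ 0 < eta, 0 <= p1 - eta, 0 <= p2 + eta &
    [/\ 3 <= L%:R * (p1 - eta) ^+ k,
       N%:R * ((p2 + eta) ^+ k + N%:R^-1) <= 3,
       (0 < L)%N & L%:R <= 13 * N%:R `^ rh]].
Proof.
move=> N3; have [] := rho_bounds; cbv zeta.
have rhE : rh = ln (1 - (2 - 2 * x) * x) / ln (1 - c * x) by [].
move: rhE; set p1 := 1 - (2 - 2 * x) * x; set p2 := 1 - c * x => rhE p1h p1_lt1 p2h p21 rh1.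
have p1_gt0 : 0 < p1 by lra.
have p2_gt0 : 0 < p2 by lra.
have N_gt0 : 0 < N%:R :> R by rewrite ltr0n; apply: leq_trans N3.
have N_ge1 : 1 <= N%:R :> R by rewrite ler1n; apply: leq_trans N3.
have lnN : 0 < ln (N%:R : R) by have := ln_ge_half N3; lra.
have a0 : 0 < - ln p2 by rewrite oppr_gt0 ln_lt0 // p2_gt0 /=; lra.
have lnp1 : ln p1 <= 0 by apply: ln_le0; lra.
(* As y <= k <= y + 1, p2^k is at most 1 / N, while p1^k is at least p1 N^(- rho), with p1 >=
   1/2. *)
pose y := ln N%:R / - ln p2; pose k := (Num.truncn y).+1.
have y0 : 0 <= y by rewrite divr_ge0 // ltW.
have /andP[ky yk] := truncn_itv y0; rewrite -/k in yk.
have ky1 : k%:R <= y + 1 by rewrite /k -natr1; lra.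
have k_ge1 : 1 <= k%:R :> R by rewrite ler1n.
have k_gt0 : 0 < k%:R :> R by apply: lt_le_trans ltr01 k_ge1.
clearbody k p1 p2.
have p2k : p2 ^+ k <= N%:R^-1.
  rewrite -ler_ln ?posrE ?exprn_gt0 ?invr_gt0 // lnXn // lnV ?posrE // -[_ *+ k]mulr_natl.
  have : y * - ln p2 <= k%:R * - ln p2 by rewrite ler_wpM2r // ltW.
  by rewrite /y divfK ?gt_eqF //; lra.
set V := N%:R `^ rh.
have V_ge1 : 1 <= V by rewrite -(powRr0 N%:R) ler_powR // rho_ge0.
have V_gt0 : 0 < V by apply: lt_le_trans ltr01 V_ge1.
have p1k : p1 / V <= p1 ^+ k.
  rewrite -ler_ln ?posrE ?exprn_gt0 ?divr_gt0 // lnXn // ln_div ?posrE // ln_powR -[_ *+ k]mulr_natl.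
  have : (y + 1) * ln p1 <= k%:R * ln p1 by rewrite ler_wnM2r.
  have -> : (y + 1) * ln p1 = ln p1 - rh * ln N%:R.
    by rewrite rhE /y; field; rewrite -oppr_eq0 gt_eqF.
  by [].
clearbody V.
have p1k_ge : (2 * V)^-1 <= p1 ^+ k.
  by apply: le_trans p1k; rewrite invfM ler_wpM2r // invr_ge0 ltW.
have p1k_gt0 : 0 < p1 ^+ k by apply: exprn_gt0.
(* The three bounds keep (p1 - eta)^k above half of p1^k, let (p2 + eta)^k exceed p2^k by at most 1
   / N, and keep p2 + eta at most 1. *)
pose e := Num.min (p1 ^+ k / 2) (Num.min N%:R^-1 (1 - p2)).
have e_gt0 : 0 < e.
  by rewrite /e !lt_min divr_gt0 // invr_gt0 N_gt0 subr_gt0; lra.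
have e1 : e <= p1 ^+ k / 2 by rewrite /e ge_min lexx.
have e2 : e <= N%:R^-1 by rewrite /e !ge_min lexx orbT.
have e3 : e <= 1 - p2 by rewrite /e !ge_min lexx !orbT.
pose eta := e / k%:R.
have eta_gt0 : 0 < eta by rewrite divr_gt0.
have eta_e : eta <= e by rewrite ler_pdivrMr // ler_peMr // ltW.
have k_eta : k%:R * eta = e by rewrite mulrC divfK // gt_eqF.
have p1k_p1 : p1 ^+ k <= p1.
  rewrite -[leRHS]expr1 ler_wiXn2l ?(ltW p1_gt0) ?(ltW p1_lt1) //.
  by rewrite -(ler1n R).
have p1_eta : 0 <= p1 - eta by lra.
(* Since (p1 - eta)^k >= 1 / (4 V), 12 V tables give the factor 3; rounding up costs at most 1 <= V,
   whence 13. *)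
exists k, (Num.truncn (12 * V)).+1, eta; split; [by []|by []|lra|].
have L_ge : 12 * V <= (Num.truncn (12 * V)).+1%:R by rewrite ltW // truncnS_gt.
split=> //.
- have lip := expr_lipschitz k p1_eta _ _ (x := p1).
  have q1k : (4 * V)^-1 <= (p1 - eta) ^+ k.
    have : p1 ^+ k - (p1 - eta) ^+ k <= k%:R * (p1 - (p1 - eta)) by apply: lip; lra.
    rewrite subKr k_eta.
    have : (4 * V)^-1 = (2 * V)^-1 / 2 by field; rewrite gt_eqF.
    lra.
  have -> : 3 = 12 * V * (4 * V)^-1 :> R by field; rewrite gt_eqF.
  by apply: ler_pM => //; rewrite ?mulr_ge0 ?invr_ge0 ?mulr_ge0 // ltW.
- have : (p2 + eta) ^+ k - p2 ^+ k <= k%:R * (p2 + eta - p2).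
    by apply: expr_lipschitz; lra.
  rewrite [X in _ * X](_ : _ = eta) ?k_eta => [lip|]; last by ring.
  have -> : 3 = N%:R * (3 * N%:R^-1) :> R by field; rewrite gt_eqF.
  by rewrite (ler_pM2l N_gt0); lra.
have /andP[L_le _] : (Num.truncn (12 * V))%:R <= 12 * V < (Num.truncn (12 * V)).+1%:R.
  by apply: truncn_itv; rewrite mulr_ge0 // ltW.
rewrite -natr1; lra.
Qed.

End TableTuning.

(** * The structures for polygons *)

Section PolygonLSH.
Context {R : realType}.

(** All distances are at most r', so a constant hash works: one key, one bucket, and fuel 2 to open
    it and inspect its first entry. *)
Lemma polygon_LSH_trivial (m n : nat) (r r' p pt qt : R) (word : nat) :
  p <= 1 -> (0 < n)%N -> (n.+2 < word)%N -> span_bound m <= r' ->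
  (6 * n).+1%:R <= pt -> 21 <= qt ->
  LSH_structure (@polygon_le_dist R m) n r r' p prep_prog query_prog word
    [:: 0; n; 1; 1; 2]%N (1 + n * 1) pt qt.
Proof.
move=> p1 n0 nw wr ptP qtP.
have near (P Q : polygon_le R m) : polygon_le_dist P Q <= r'.
  exact: le_trans (polygon_dist_le_span (svalP P) (svalP Q)) wr.
apply: (@LSH_of_finite R _ _ _ _ _ _ 1 1 2 word 0 pt qt unit (fun _ _ _ => 0%N)); rewrite ?muln1 ?card_unit //; try lia.
move=> data q [i di]; exists xpredT; split.
  by rewrite /fraction (_ : #|xpredT| = #|{: unit}|) ?card_unit ?divr1 //; apply: eq_card.
move=> _ _; split; first by exists i, ord0, ord0.
rewrite big1 // => j' _; rewrite big1 // => i' _; rewrite big1 // => j _.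
by rewrite ltNge near.
Qed.

(** The fuel 7 L m covers fewer than 6 L m far entries and the opening of L m buckets. With B + 1 =
    n m, the [L] tables use L n m head cells and as many links. *)
Lemma polygon_LSH_tables (m n : nat) (r c pt qt : R) (k L word : nat) (eta : R) :
  let x := scaled_radius m r in
  let q1 := 1 - (2 - 2 * x) * x - eta in let q2 := 1 - c * x + eta in
  (0 < m)%N -> (0 < n)%N -> (0 < L)%N -> 0 < r -> 1 <= c -> c * r < span_bound m ->
  0 < eta -> 0 <= q1 -> 0 <= q2 ->
  3 <= L%:R * q1 ^+ k -> (n * m)%N%:R * (q2 ^+ k + (n * m)%N%:R^-1) <= 3 ->
  (7 * (L * (n * m)) < word)%N ->
  (6 * (L * (n * m))).+1%:R <= pt -> (70 * (L * m) + 1)%N%:R <= qt ->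
  LSH_structure (@polygon_le_dist R m) n r (c * r) 4^-1 prep_prog query_prog word
    [:: 0; n; L * m; L * (n * m); 7 * (L * m)]%N (L * (n * m) + n * (L * m)) pt qt.
Proof.
move=> x q1 q2 m0 n0 L0 r0 c1 crw eta0 q10 q20 Lq Nq ww ptP qtP.
have w0 : 0 < span_bound m :> R := span_bound_gt0 m.
have xE : x = r / (2 * span_bound m) by rewrite /x /scaled_radius scaled_radius_denominatorE.
have rcr : r <= c * r by rewrite ler_peMl // ltW.
have rw : r < span_bound m by apply: le_lt_trans crw.
have [A [b [A0 bits]]] := @polygon_bits R m r (c * r) eta eta0 (ltW r0) rw.
pose bm (P : polygon_le R m) := b (sval P).
have N0 : (0 < n * m)%N by rewrite muln_gt0 n0.
pose B := (n * m).-1; have BE : B.+1 = (n * m)%N by rewrite prednK.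
have q1E : 1 - (2 * r - r ^+ 2 / span_bound m) / (2 * span_bound m) - eta = q1.
  by rewrite /q1 xE; field; rewrite gt_eqF.
have q2E : 1 - c * r / (2 * span_bound m) + eta = q2 by rewrite /q2 xE mulrA.
have Lm0 : (0 < L * m)%N by rewrite muln_gt0 L0.
have nLm : (n * (L * m) = L * (n * m))%N by rewrite mulnCA.
have le1 : (L * m <= L * (n * m))%N by rewrite -nLm leq_pmull.
have le2 : (n <= L * (n * m))%N by rewrite -nLm leq_pmulr.
have [w1 w2 w3 w4] : [/\ L * (n * m) < word, L * m < word, n < word & 7 * (L * m) < word]%N.
  move: ww le1 le2; move: (L * (n * m))%N (L * m)%N => a e; clear => *.
  by split; lia.
apply: (@LSH_of_finite R _ _ _ _ _ _ (L * m) (L * (n * m)) (7 * (L * m)) word 0 pt qt _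
  (lsh_hash bm m (k := k) (B := B) (L := L))) => //.
- by rewrite card_ffun expn_gt0 card_table_seed_gt0.
- by move=> w j P jJ; rewrite -BE; apply: lsh_hash_lt.
- by rewrite nLm.
- by rewrite nLm.
- by rewrite mulnA.
move=> data q [i0 near]; have [hn _] := bits _ _ (svalP (tnth data i0)) (svalP q).
have [s0 [s0' [s0m s0'm]]] := hn near.
rewrite q1E => near_q.
pose far i := c * r < polygon_le_dist (tnth data i) q.
have [||good [pg hg]] := @lsh_success R _ A bm k B L m A0 m0 n (tnth data) far q i0
  (Ordinal s0m) (Ordinal s0'm) q1 q2 n0 L0 q10 q20 near_q Lq.
- move=> i s s' fi; have [_ hf] := bits _ _ (svalP (tnth data i)) (svalP q).
  by rewrite -q2E; apply: hf.
- by rewrite BE.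
exists good; split=> // w gw; have [[j [j' e]] farle] := hg w gw; split.
  by exists i0, j, j'; split=> //; apply: le_trans near rcr.
by rewrite mulSn addnC ltn_add2l.
Qed.

(** The exponent 7 suffices because 7 * 13 N^2 = 91 N^2 is less than 3^5 N^2 <= N^7. *)
Lemma word_bounds (N L : nat) : (3 <= N -> L <= 13 * N ->
  N.+2 < N ^ 7 /\ 7 * (L * N) < N ^ 7)%N.
Proof.
move=> N3 LN; have : (3 ^ 5 * (N * N) <= N ^ 7)%N.
  by rewrite -[7%N]/(5 + 2)%N expnD mulnn leq_mul2r leq_exp2r // N3 orbT.
have : (3 * N <= N * N)%N by rewrite leq_mul2r N3 orbT.
have : (L * N <= 13 * (N * N))%N by rewrite mulnA leq_mul2r LN orbT.
rewrite -[(3 ^ 5)%N]/243%N; move: (N * N)%N (L * N)%N (N ^ 7)%N N3; clear => x y z *.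
by split; lia.
Qed.

End PolygonLSH.

Theorem theoremC3 (R : realType) :
  exists (prep query : cmd) (w : nat) (p K : R),
    0 < p /\
    forall (m n : nat) (r c : R),
      (3 <= m)%N -> (0 < n)%N -> 0 < r -> 1 <= c ->
      2 - r / (lambda m / 2 + 2 * pi) < c ->
      exists (params : seq nat) (space : nat),
        space%:R <= K * (n * m)%N%:R `^ (1 + rho m r c) /\
        LSH_structure (@polygon_le_dist R m) n r (c * r) p
          prep query ((n * m) ^ w)%N params space
          (K * (n * m)%N%:R `^ (1 + rho m r c))
          (K * (m%:R `^ (1 + rho m r c) * n%:R `^ rho m r c
                * ln (n * m)%N%:R)).
Proof.
exists prep_prog, query_prog, 7%N, 4^-1, 2000; split; first by rewrite invr_gt0.
move=> m n r c m3 n0 r0 c1 c2.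
have m0 : (0 < m)%N by apply: leq_trans m3.
have N3 : (3 <= n * m)%N by apply: leq_trans m3 _; rewrite leq_pmull.
have mN : (m <= n * m)%N by rewrite leq_pmull.
have nN : (n <= n * m)%N by rewrite leq_pmulr.
have rho0 : 0 <= rho m r c by apply: rho_ge0.
have lnN : 2^-1 <= ln ((n * m)%N%:R : R) by exact: ln_ge_half.
have N1 : 1 <= (n * m)%N%:R :> R by rewrite ler1n; apply: leq_trans N3.
have N0 : 0 < (n * m)%N%:R :> R by apply: lt_le_trans ltr01 N1.
have mR1 : 1 <= m%:R :> R by rewrite ler1n.
have mR0 : 0 < m%:R :> R by apply: lt_le_trans ltr01 mR1.
set V : R := (n * m)%N%:R `^ rho m r c.
have V1 : 1 <= V by apply: le_trans (ler_powR N1 rho0); rewrite powRr0.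
have V0 : 0 < V by apply: lt_le_trans ltr01 V1.
have NV : (n * m)%N%:R `^ (1 + rho m r c) = (n * m)%N%:R * V.
  by rewrite powRD ?powRr1 ?ler0n //; apply/implyP => _; rewrite gt_eqF.
have mV : m%:R `^ (1 + rho m r c) * n%:R `^ rho m r c = m%:R * V.
  rewrite powRD ?powRr1 ?ler0n //; last by apply/implyP => _; rewrite gt_eqF.
  by rewrite -mulrA -powRM ?ler0n // -natrM mulnC.
have N_le : (n * m)%N%:R <= (n * m)%N%:R * V by rewrite ler_peMr // ltW.
have m_le : m%:R <= m%:R * V by rewrite ler_peMr // ltW.
(* The query takes at most 70 * 13 m V + 1 <= 1000 m V steps, and the logarithm is at least 1/2;
   this is where the constant 2000 comes from. *)
have mVln : 1000 * (m%:R * V) <= 2000 * (m%:R * V * ln (n * m)%N%:R).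
  have : m%:R * V * 2^-1 <= m%:R * V * ln (n * m)%N%:R.
    by rewrite ler_wpM2l // mulr_ge0 // ltW.
  lra.
rewrite NV mV.
have [wcr|crw] := leP (span_bound m) (c * r).
  exists [:: 0; n; 1; 1; 2]%N, (1 + n * 1)%N.
  have nR : n%:R <= (n * m)%N%:R :> R by rewrite ler_nat.
  split; first by rewrite muln1 natrD; lra.
  apply: polygon_LSH_trivial => //.
  - by rewrite invf_le1 // ler1n.
  - by have [+ _] := word_bounds (L := 0) N3 isT; apply: leq_ltn_trans; rewrite !ltnS.
  - by rewrite -natr1 natrM; lra.
  - by apply: le_trans mVln; lra.
have [k [L [eta [eta0 q10 q20 [Lq Nq L0 LV]]]]] := lsh_parameters r0 c1 crw c2 N3.
(* As rho is at most 1, the number of tables is linear in n m, so every stored value fits in a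
   word. *)
have LN : (L <= 13 * (n * m))%N.
  rewrite -(ler_nat R) natrM; apply: le_trans LV _.
  rewrite ler_pM2l // ler1_powR // /rho.
  by have [] := rho_bounds r0 c1 crw c2.
exists [:: 0; n; L * m; L * (n * m); 7 * (L * m)]%N, (L * (n * m) + n * (L * m))%N.
have LNV : (L * (n * m))%N%:R <= 13 * ((n * m)%N%:R * V).
  by rewrite natrM mulrCA mulrC ler_wpM2l // ltW.
have LmV : (L * m)%N%:R <= 13 * (m%:R * V).
  by rewrite natrM mulrCA mulrC ler_wpM2l // ltW.
split.
  rewrite (_ : n * (L * m) = L * (n * m))%N ?natrD; last by rewrite mulnCA.
  lra.
apply: polygon_LSH_tables Lq Nq _ _ _ => //.
- by have [] := word_bounds N3 LN.
- by rewrite -natr1 natrM; lra.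
by apply: le_trans mVln; rewrite natrD natrM; lra.
Qed.
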